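(* Let $n\ge1$. The repeated dual-reciprocals of generalised power sum hypersurfaces $V(\mathfrak{f}_p)\subset\mathbb{P}^n$ are given by $$(\mathcal{D}\mathcal{R})^k\,V(\mathfrak{f}_p)=V(\mathfrak{f}_{p/(1+kp)})\qquad\text{for all } k\in\mathbb{N},\ p\in\mathbb{Q}\setminus\{0,-\tfrac1k,-\tfrac1{k-1},\ldots,-1\},$$ and $$(\mathcal{R}\mathcal{D})^k\,V(\mathfrak{f}_p)=V(\mathfrak{f}_{p/(1-kp)})\qquad\text{for all } k\in\mathbb{N},\ p\in\mathbb{Q}\setminus\{0,\tfrac1k,\tfrac1{k-1},\ldots,1\}.$$
   Context: We work over $\mathbb{C}$, and polynomials in $\mathbb{C}[x_0,\ldots,x_n]$ are considered up to non-zero scalars. Here $\mathbb{N}$ includes $0$, and for $k=0$ only the value $p=0$ is excluded. Coordinate-wise powers: for $r\in\mathbb{Z}\setminus\{0\}$ let $\varphi_r\colon\mathbb{P}^n\dashrightarrow\mathbb{P}^n$, $[x_0:\ldots:x_n]\mapsto[x_0^r:\ldots:x_n^r]$. For a variety $X\subset\mathbb{P}^n$ put $X^{\circ r}:=\varphi_r(X)$ if $r>0$, and $X^{\circ r}:=\overline{\varphi_r(X\setminus V(x_0x_1\cdots x_n))}$ if $r<0$ (for $r<0$ only varieties with no irreducible component contained in a coordinate hyperplane are considered). Power sums: for a positive integer $s$ let $\mathfrak{f}_s:=x_0^s+\ldots+x_n^s$ and $\mathfrak{f}_{-s}:=\sum_{i=0}^n\prod_{j\ne i}x_j^s$, and let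 $\mathfrak{f}_0:=1$. For $s\in\mathbb{Z}\setminus\{0\}$ and $r\in\mathbb{Z}\setminus\{0\}$ let $\mathfrak{f}_s^{\circ r}$ be the square-free defining polynomial (up to scaling) of the hypersurface $V(\mathfrak{f}_s)^{\circ r}\subset\mathbb{P}^n$, and $\mathfrak{f}_0^{\circ r}:=1$. For a rational number $p=\frac sr$ ($s,r\in\mathbb{Z}$, $r\ne0$) the generalised power sum polynomial is $\mathfrak{f}_p:=\mathfrak{f}_s^{\circ r}$; this does not depend on the choice of $s,r$. Reciprocal and dual: for a hypersurface $V(f)\subset\mathbb{P}^n$ not containing any coordinate hyperplane, the reciprocal variety is $\mathcal{R}V(f):=V(f)^{\circ(-1)}$. The dual variety $\mathcal{D}V(f)=V(f)^*$ of a hypersurface $V(f)\subset\mathbb{P}^n$ is the Zariski closure in $(\mathbb{P}^n)^*$ of the set of hyperplanes that arise as the projective tangent space at a smooth point of $V(f)$; $(\mathbb{P}^n)^*$ is identified with $\mathbb{P}^n$ via the standard bilinear form on $\mathbb{C}^{n+1}$. The notation $\mathcal{D}\mathcal{R}\,V$ means $\mathcal{D}(\mathcal{R}V)$, and $(\mathcal{D}\mathcal{R})^k$ is the $k$-fold iteration. *)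

(* Defs.v *)
From HB Require Import structures.
From mathcomp Require Import all_boot all_order all_algebra.
From mathcomp Require Import boolp classical_sets reals complex mpoly.

Set Implicit Arguments.
Unset Strict Implicit.
Unset Printing Implicit Defensive.

Import Order.TTheory GRing.Theory Num.Theory.

Local Open Scope classical_set_scope.
Local Open Scope ring_scope.

(* The complex numbers are R[i] for R : realType.  A subset of P^n is
   represented by the set of all its homogeneous coordinate vectors: a set of
   non-zero vectors of C^(n+1) stable under non-zero scaling.  Equality of
   such sets is equality of subsets of P^n.  The dual space (P^n)^* is
   identified with P^n by the form (h, v) |-> \sum_i h_i v_i. *)

Section ProjectiveSets.

Variables (R : realType) (n : nat).

Local Notation C := R[i].
Local Notation vec := 'rV[C]_n.+1.
Local Notation pol := {mpoly C[n.+1]}.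

Definition zero_locus (f : pol) : set vec :=
  [set x : vec | x != 0 /\ f.@[x 0] = 0].

Definition vanishes_on (A : set vec) (f : pol) : Prop :=
  forall x, A x -> f.@[x 0] = 0.

Definition zariski_closure (A : set vec) : set vec :=
  [set y : vec | y != 0 /\
    forall (d : nat) (f : pol),
      f \is d.-homog -> vanishes_on A f -> f.@[y 0] = 0].

Definition in_torus (x : vec) : Prop := forall i, x 0 i != 0.

Definition pow_map (r : int) (x : vec) : vec := map_mx (fun a : C => a ^ r) x.

Definition pow_image (r : int) (A : set vec) : set vec :=
  [set y | exists x : vec, exists c : C,
    [/\ A x, c != 0 & y = c *: pow_map r x]].

Definition coord_pow (r : int) (X : set vec) : set vec :=
  if 0 < r then pow_image r X
  else zariski_closure (pow_image r [set x | X x /\ in_torus x]).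

Definition reciprocal (X : set vec) : set vec := coord_pow (- 1) X.

Definition hyperplane (h : vec) : set vec :=
  [set v : vec | v != 0 /\ \sum_(i < n.+1) h 0 i * v 0 i = 0].

Definition tangent_space (X : set vec) (x : vec) : set vec :=
  [set v : vec | v != 0 /\
    forall (d : nat) (f : pol), f \is d.-homog -> vanishes_on X f ->
      \sum_(i < n.+1) (f^`M(i)).@[x 0] * v 0 i = 0].

(* A point x of a hypersurface X is smooth exactly when the Jacobian of the
   vanishing ideal of X has rank 1 at x, i.e. when the projective tangent
   space (the kernel of that Jacobian) is a hyperplane. *)
Definition dual (X : set vec) : set vec :=
  zariski_closure
    [set h : vec | h != 0 /\ exists x, X x /\ tangent_space X x = hyperplane h].

Definition power_sum (s : int) : pol :=
  if s == 0 then 1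
  else if 0 < s then \sum_(i < n.+1) 'X_i ^+ `|s|%N
  else \sum_(i < n.+1) \prod_(j < n.+1 | j != i) 'X_j ^+ `|s|%N.

Definition square_free (f : pol) : Prop :=
  forall g q : pol, f = g ^+ 2 * q -> exists2 c : C, c != 0 & g = c%:MP.

Definition square_free_defining (X : set vec) (f : pol) : Prop :=
  [/\ exists d : nat, f \is d.-homog, square_free f & zero_locus f = X].

Definition is_gen_power_sum (p : rat) (f : pol) : Prop :=
  exists s r : int, [/\ r != 0, p = s%:~R / r%:~R &
    if s == 0 then f = 1
    else square_free_defining (coord_pow r (zero_locus (power_sum s))) f].

(* An arbitrary choice among the representations p = s / r and among the
   scalar multiples of the square-free defining polynomial. *)
Definition gen_power_sum (p : rat) : pol := xget 1 (is_gen_power_sum p).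

End ProjectiveSets.

Arguments power_sum R n s : clear implicits.
Arguments gen_power_sum R n p : clear implicits.

(* Main.v *)
(** On the torus, [V(f_p)] for [p = s / r] is the set of all [u ^ r] with
    [\sum_i u_i ^ s = 0], which depends only on [p]; call it the branch set.  The
    norm polynomial [N (x ^ r) = \prod_zeta f_s (zeta x)], over tuples [zeta] of
    [r]-th roots of unity, is a homogeneous equation for its Zariski closure, so
    the closed set [V(f_s)^(o r)] is that closure and has no further torus points.
    Hence the reciprocal of [V(f_p)] is [V(f_(-p))].

    Differentiating along curves in the branch shows that the gradient at [u ^ r]
    of any polynomial vanishing on the branch is a multiple of [u ^ (s - r)], a
    point of the branch set for [s / (s - r)].  If [G] vanishes on the latter,
    then [G] composed with a gradient vanishes on [V(f_p)], singular and boundary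
    points included; so the dual lies in [V(f_(p / (p - 1)))].  Conversely, the
    gradient of [N] does not vanish at points [u ^ r] lying on a single branch, and
    those are dense for the usual topology of [C].  Thus [p |-> - p |-> p / (p + 1)]
    describes one dual-reciprocal step, and the formulas follow by iteration. *)
Require Import Defs.
From mathcomp Require Import all_boot all_order all_algebra.
From mathcomp Require Import boolp classical_sets reals complex mpoly.
From mathcomp Require Import cyclic separable cyclotomic.
From mathcomp Require Import ring lra zify.

Set Implicit Arguments.
Unset Strict Implicit.
Unset Printing Implicit Defensive.

Import Order.TTheory GRing.Theory Num.Theory.

Local Open Scope classical_set_scope.
Local Open Scope ring_scope.

(** * Limits of sequences and difference quotients *)

Section Sequences.
Variable F : numFieldType.
Implicit Types (u v : nat -> F) (l m : F).

(** In [R[i]] the condition [0 < e] forces [e] to be real, so this is convergence for the usual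
    absolute value. *)
Definition tends u l :=
  forall e : F, 0 < e -> exists N, forall k, (N <= k)%N -> `|u k - l| < e.

Definition eventually (P : nat -> Prop) := exists N, forall k, (N <= k)%N -> P k.

Lemma eventuallyI (P Q : nat -> Prop) :
  eventually P -> eventually Q -> eventually (fun k => P k /\ Q k).
Proof.
move=> [N1 h1] [N2 h2]; exists (maxn N1 N2) => k; rewrite geq_max => /andP[k1 k2].
by split; [exact: h1|exact: h2].
Qed.

Lemma eventually_sub (P Q : nat -> Prop) :
  (forall k, P k -> Q k) -> eventually P -> eventually Q.
Proof. by move=> PQ [N h]; exists N => k /h /PQ. Qed.

Lemma eventually_fin (T : finType) (P : T -> nat -> Prop) :
  (forall i, eventually (P i)) -> eventually (fun k => forall i, P i k).
Proof.
move=> h; pose N i := projT1 (cid (h i)).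
exists (\max_i N i) => k hk i; apply: (projT2 (cid (h i))).
exact: leq_trans (leq_bigmax i) hk.
Qed.

Lemma tends_cst l : tends (fun=> l) l.
Proof. by move=> e e0; exists 0%N => k _; rewrite subrr normr0. Qed.

Lemma tends_eventually u v l :
  eventually (fun k => u k = v k) -> tends u l -> tends v l.
Proof.
move=> uv ul e e0; apply: eventually_sub (eventuallyI uv (ul e e0)).
by move=> k [<-].
Qed.

Lemma eq_tends u v l : u =1 v -> tends u l -> tends v l.
Proof. by move=> uv; apply: tends_eventually; exists 0%N => k _. Qed.

Lemma tendsD u v l m : tends u l -> tends v m -> tends (fun k => u k + v k) (l + m).
Proof.
move=> ul vm e e0; have e2 : 0 < e / 2%:R by rewrite divr_gt0 ?ltr0n.
apply: eventually_sub (eventuallyI (ul _ e2) (vm _ e2)) => k [h1 h2].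
have -> : u k + v k - (l + m) = (u k - l) + (v k - m) by ring.
have -> : e = e / 2%:R + e / 2%:R by field.
exact: le_lt_trans (ler_normD _ _) (ltrD h1 h2).
Qed.

Lemma tendsM u v l m : tends u l -> tends v m -> tends (fun k => u k * v k) (l * m).
Proof.
move=> ul vm e e0.
have a0 : 0 <= `|l| + `|m| by rewrite addr_ge0.
have b0 : 0 < 1 + (`|l| + `|m|) + e by rewrite ltr_wpDl // addr_ge0.
(* As [d < 1], the product of the two errors is at most [d], so the total error is at most
   [d * (1 + |l| + |m|) < e]. *)
pose d := e / (1 + (`|l| + `|m|) + e).
have d0 : 0 < d by rewrite divr_gt0.
have d1 : d < 1 by rewrite ltr_pdivrMr // mul1r ltr_pwDl // ltr_wpDr.
have dE : d * (1 + (`|l| + `|m|)) < e.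
  rewrite /d mulrAC ltr_pdivrMr // ltr_pM2l // ltr_pwDr //.
apply: eventually_sub (eventuallyI (ul _ d0) (vm _ d0)) => k [h1 h2].
have -> : u k * v k - l * m = (u k - l) * (v k - m) + ((u k - l) * m + l * (v k - m)).
  by ring.
apply: le_lt_trans dE; apply: le_trans (ler_normD _ _) _.
rewrite [leRHS]mulrDr mulr1; apply: lerD.
  rewrite normrM -[leRHS]mulr1; apply: ler_pM => //; first exact: ltW.
  exact: ltW (lt_trans h2 d1).
apply: le_trans (ler_normD _ _) _; rewrite [leRHS]mulrDr addrC; apply: lerD.
  by rewrite normrM mulrC; apply: ler_wpM2r => //; exact: ltW.
by rewrite normrM; apply: ler_wpM2r => //; exact: ltW.
Qed.

Lemma tendsMl c u l : tends u l -> tends (fun k => c * u k) (c * l).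
Proof. exact/tendsM/tends_cst. Qed.

Lemma tendsN u l : tends u l -> tends (fun k => - u k) (- l).
Proof.
by move=> /(tendsMl (-1)); rewrite mulN1r; apply: eq_tends => k; rewrite mulN1r.
Qed.

Lemma tendsB u v l m : tends u l -> tends v m -> tends (fun k => u k - v k) (l - m).
Proof. by move=> ul /tendsN; apply: tendsD. Qed.

Lemma tends_neq0 u l : tends u l -> l != 0 -> eventually (fun k => u k != 0).
Proof.
move=> ul l0; have := ul `|l|; rewrite normr_gt0 => /(_ l0).
apply: eventually_sub => k; apply: contraTneq => ->.
by rewrite sub0r normrN ltxx.
Qed.

Lemma tendsV u l : tends u l -> l != 0 -> tends (fun k => (u k)^-1) l^-1.
Proof.
move=> ul l0 e e0; have nl0 : 0 < `|l| by rewrite normr_gt0.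
(* The error is [|l - u k| / (|l| |u k|)]; being within [|l| / 2] of [l] keeps [|u k|] above
   [|l| / 2]. *)
have h1 : 0 < `|l| / 2%:R by rewrite divr_gt0 ?ltr0n.
have h2 : 0 < e * (`|l| * (`|l| / 2%:R)) by rewrite !mulr_gt0 ?invr_gt0 ?ltr0n.
apply: eventually_sub (eventuallyI (tends_neq0 ul l0)
  (eventuallyI (ul _ h1) (ul _ h2))) => k [uk0 [k1 k2]].
have -> : (u k)^-1 - l^-1 = (l - u k) / (l * u k) by field; apply/andP; split.
have nu : `|l| / 2%:R <= `|u k|.
  have -> : `|l| / 2%:R = `|l| - `|l| / 2%:R by field.
  rewrite lerBlDr [leLHS](_ : _ = `|u k - (u k - l)|); last by congr (`|_|); ring.
  by apply: le_trans (ler_normB _ _) _; rewrite lerD2l; exact: ltW.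
rewrite normrM normfV distrC ltr_pdivrMr ?normr_gt0 ?mulf_neq0 //.
apply: lt_le_trans k2 _; rewrite normrM ler_pM2l // ler_pM2l //.
Qed.

Lemma tends_uniq u l m : tends u l -> tends u m -> l = m.
Proof.
move=> ul um; apply/eqP; rewrite -subr_eq0; apply/negPn/negP => lm.
have lm0 : 0 < `|l - m| by rewrite normr_gt0.
have [N /(_ N (leqnn N))] := tendsB ul um lm0.
by rewrite subrr sub0r normrN ltxx.
Qed.

Lemma tends_sum (I : Type) (r : seq I) (P : pred I) (a : I -> nat -> F) b :
  (forall i, tends (a i) (b i)) ->
  tends (fun k => \sum_(i <- r | P i) a i k) (\sum_(i <- r | P i) b i).
Proof.
move=> ab; elim: r => [|i r IH].
  by rewrite big_nil; apply: eq_tends (tends_cst 0) => k; rewrite big_nil.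
rewrite big_cons; case: ifP => Pi.
  by apply: eq_tends (tendsD (ab i) IH) => k; rewrite big_cons Pi.
by apply: eq_tends IH => k; rewrite big_cons Pi.
Qed.

Lemma tends_prod (I : Type) (r : seq I) (P : pred I) (a : I -> nat -> F) b :
  (forall i, tends (a i) (b i)) ->
  tends (fun k => \prod_(i <- r | P i) a i k) (\prod_(i <- r | P i) b i).
Proof.
move=> ab; elim: r => [|i r IH].
  by rewrite big_nil; apply: eq_tends (tends_cst 1) => k; rewrite big_nil.
rewrite big_cons; case: ifP => Pi.
  by apply: eq_tends (tendsM (ab i) IH) => k; rewrite big_cons Pi.
by apply: eq_tends IH => k; rewrite big_cons Pi.
Qed.

Lemma tendsX j u l : tends u l -> tends (fun k => u k ^+ j) (l ^+ j).
Proof.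
move=> ul; elim: j => [|j IH]; first exact: tends_cst.
by rewrite exprS; apply: eq_tends (tendsM ul IH) => k; rewrite exprS.
Qed.

Lemma tends_exprz (j : int) u l : tends u l -> l != 0 ->
  tends (fun k => u k ^ j) (l ^ j).
Proof.
move=> ul l0; case: j => j; first exact: tendsX.
by rewrite NegzE -exprz_inv; apply: eq_tends (tendsX j.+1 (tendsV ul l0)) => k;
  rewrite -exprz_inv.
Qed.

(** Induction along the ring operations instead of monomials, so that limits and derivatives only
    have to treat sums and products. *)
Lemma mpoly_ring_ind n (P : {mpoly F[n]} -> Prop) :
  (forall c, P c%:MP) -> (forall i, P 'X_i) ->
  (forall p q, P p -> P q -> P (p + q)) ->
  (forall p q, P p -> P q -> P (p * q)) -> forall p, P p.
Proof.
move=> PC PX PD PM p; elim/mpolyind: p => [|c m p _ _ Pp]; first by rewrite -mpolyC0.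
apply: PD => //; rewrite -mul_mpolyC; apply: (PM) => //; rewrite mpolyXE_id.
apply: (big_ind P) => [|p1 p2|i _]; [by rewrite -mpolyC1|exact: PM|].
elim: (m i) => [|j IH]; first by rewrite expr0 -mpolyC1.
by rewrite exprS; apply: PM.
Qed.

Lemma tends_meval n (p : {mpoly F[n]}) (y : nat -> 'I_n -> F) (z : 'I_n -> F) :
  (forall i, tends (y^~ i) (z i)) -> tends (fun k => p.@[y k]) p.@[z].
Proof.
move=> yz; elim/mpoly_ring_ind: p => [c|i|p q hp hq|p q hp hq].
- by rewrite mevalC; apply: eq_tends (tends_cst c) => k; rewrite mevalC.
- by rewrite mevalXU; apply: eq_tends (yz i) => k; rewrite mevalXU.
- by rewrite mevalD; apply: eq_tends (tendsD hp hq) => k; rewrite mevalD.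
- by rewrite mevalM; apply: eq_tends (tendsM hp hq) => k; rewrite mevalM.
Qed.

(** * Difference quotients along a null sequence *)

Section Differences.
Variable t : nat -> F.
Hypothesis t_neq0 : forall k, t k != 0.
Hypothesis t_tends0 : tends t 0.

(** Here [m] plays the derivative at parameter 0 of a curve with value [l] there, sampled only at
    the parameters [t k]. *)
Definition dtends u l m := tends (fun k => (u k - l) / t k) m.

Lemma dtends_tends u l m : dtends u l m -> tends u l.
Proof.
move=> h; have := tendsD (tendsM h t_tends0) (tends_cst l).
by rewrite mulr0 add0r; apply: eq_tends => k; rewrite divfK // subrK.
Qed.

Lemma dtends_cst l : dtends (fun=> l) l 0.
Proof. by apply: eq_tends (tends_cst 0) => k; rewrite subrr mul0r. Qed.

Lemma eq_dtends u v l m : u =1 v -> dtends u l m -> dtends v l m.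
Proof. by move=> uv; apply: eq_tends => k; rewrite uv. Qed.

Lemma dtends_lin l m : dtends (fun k => l + t k * m) l m.
Proof. by apply: eq_tends (tends_cst m) => k; rewrite addrC addKr mulrC mulKf. Qed.

Lemma dtendsD u v l m l' m' : dtends u l l' -> dtends v m m' ->
  dtends (fun k => u k + v k) (l + m) (l' + m').
Proof.
by move=> h1 h2; apply: eq_tends (tendsD h1 h2) => k; rewrite -mulrDl; congr (_ / _); ring.
Qed.

Lemma dtendsM u v l m l' m' : dtends u l l' -> dtends v m m' ->
  dtends (fun k => u k * v k) (l * m) (l' * m + l * m').
Proof.
move=> h1 h2; have := tendsD (tendsM h1 (dtends_tends h2)) (tendsMl l h2).
by apply: eq_tends => k; field.
Qed.

Lemma dtendsV u l m : l != 0 -> dtends u l m ->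
  dtends (fun k => (u k)^-1) l^-1 (- (m / l ^+ 2)).
Proof.
move=> l0 h; have ul := dtends_tends h.
have := tendsN (tendsM h (tendsMl l^-1 (tendsV ul l0))).
rewrite (_ : l^-1 / l = (l ^+ 2)^-1); last by field.
apply: tends_eventually; apply: eventually_sub (tends_neq0 ul l0) => k uk0.
by field; rewrite ?l0 ?uk0 ?t_neq0.
Qed.

Lemma dtendsX j u l m : dtends u l m ->
  dtends (fun k => u k ^+ j) (l ^+ j) (j%:R * l ^+ j.-1 * m).
Proof.
move=> h; elim: j => [|j IH].
  by rewrite mul0r mul0r; exact: dtends_cst.
rewrite exprS [X in dtends _ _ X](_ : _ = m * l ^+ j + l * (j%:R * l ^+ j.-1 * m)).
  by apply: eq_dtends (dtendsM h IH) => k; rewrite exprS.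
by case: j {IH} => [|j] /=; rewrite ?exprS; ring.
Qed.

Lemma dtends_exprz (j : int) u l m : l != 0 -> dtends u l m ->
  dtends (fun k => u k ^ j) (l ^ j) (j%:~R * l ^ (j - 1) * m).
Proof.
move=> l0 h; case: j => [[|j]|j].
- by rewrite /= mul0r mul0r; exact: dtends_cst.
- by rewrite (_ : Posz j.+1 - 1 = j); [exact: dtendsX|lia].
have := dtendsX j.+1 (dtendsV l0 h); rewrite NegzE -exprz_inv.
rewrite (_ : _ * - (m / _) = (- j.+1%:Z)%:~R * l ^ (- j.+1%:Z - 1) * m).
  by apply: eq_dtends => k; rewrite -exprz_inv.
rewrite (_ : - j.+1%:Z - 1 = - (j.+2%:Z)); last by lia.
rewrite -exprnN -!exprVn mulrNz -pmulrn /= !exprS.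
by field.
Qed.

(** Divide [u ^ j - l ^ j] by its cofactor of [u - l], which tends to [j * l ^ (j - 1)]. The
    hypothesis [tends u l] says which root is followed. *)
Lemma dtends_root j u l w : l != 0 -> (0 < j)%N -> tends u l ->
  dtends (fun k => u k ^+ j) (l ^+ j) w ->
  dtends u l (w / (j%:R * l ^+ j.-1)).
Proof.
move=> l0 j0 ul h.
have hb : tends (fun k => \sum_(i < j) u k ^+ (j.-1 - i) * l ^+ i)
    (j%:R * l ^+ j.-1).
  rewrite (_ : j%:R * _ = \sum_(i < j) l ^+ (j.-1 - i) * l ^+ i).
    by apply: tends_sum => i; apply: tendsM (tendsX _ ul) (tends_cst _).
  rewrite (eq_bigr (fun=> l ^+ j.-1)) => [|i _].
    by rewrite sumr_const card_ord mulr_natl.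
  by rewrite -exprD subnK // -ltnS prednK.
have b0 : j%:R * l ^+ j.-1 != 0 by rewrite mulf_neq0 ?expf_neq0 // pnatr_eq0 -lt0n.
have := tendsM h (tendsV hb b0); apply: tends_eventually.
apply: eventually_sub (tends_neq0 hb b0) => k bk0.
by rewrite subrXX mulrAC mulfK.
Qed.

Lemma dtends_meval n (p : {mpoly F[n]}) (y : nat -> 'I_n -> F) (z v : 'I_n -> F) :
  (forall i, dtends (y^~ i) (z i) (v i)) ->
  dtends (fun k => p.@[y k]) p.@[z] (\sum_i (p^`M(i)).@[z] * v i).
Proof.
move=> yz; elim/mpoly_ring_ind: p => [c|i|p q hp hq|p q hp hq].
- rewrite mevalC big1 => [|i _]; last by rewrite mderivC meval0 mul0r.
  by apply: eq_dtends (dtends_cst c) => k; rewrite mevalC.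
- rewrite mevalXU (bigD1 i) //= mderivX mnm1E eqxx.
  rewrite (_ : (U_(i) - U_(i))%MM = 0%MM); last by apply/mnmP=> j; rewrite mnmBE subnn mnm0E.
  rewrite mpolyX0 scale1r meval1 mul1r big1 => [|j ji].
    by rewrite addr0; apply: eq_dtends (yz i) => k; rewrite mevalXU.
  by rewrite mderivX mnm1E eq_sym (negPf ji) scale0r meval0 mul0r.
- rewrite mevalD (eq_bigr (fun i => (p^`M(i)).@[z] * v i + (q^`M(i)).@[z] * v i)).
    by rewrite big_split; apply: eq_dtends (dtendsD hp hq) => k; rewrite mevalD.
  by move=> i _; rewrite mderivD mevalD mulrDl.
- rewrite mevalM (eq_bigr (fun i => (p^`M(i)).@[z] * v i * q.@[z] + p.@[z] * ((q^`M(i)).@[z] * v i))).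
    rewrite big_split -mulr_suml -mulr_sumr.
    by apply: eq_dtends (dtendsM hp hq) => k; rewrite mevalM.
  by move=> i _; rewrite mderivM mevalD !mevalM; ring.
Qed.

End Differences.
End Sequences.

(** * Roots *)

Section Roots.
Variable C : numClosedFieldType.

(* [`|x ^+ m - z|] is the product of the distances from [x] to the [m] roots. *)
Lemma near_root (m : nat) (x z : C) : (0 < m)%N ->
  exists2 y, y ^+ m = z & `|y - x| ^+ m <= `|x ^+ m - z|.
Proof.
move=> m0; have [r Er] := closed_field_poly_normal ('X^m - z%:P).
have sp : size ('X^m - z%:P) = m.+1 by rewrite size_XnsubC.
have lc : lead_coef ('X^m - z%:P) = 1 by exact/eqP/monicXnsubC.
have sr : size r = m.
  by move: sp; rewrite Er lc scale1r size_prod_XsubC => -[].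
have hx : x ^+ m - z = \prod_(a <- r) (x - a).
  rewrite -[LHS](_ : ('X^m - z%:P).[x] = _); last by rewrite !hornerE.
  rewrite Er lc scale1r horner_prod; apply: eq_bigr => a _; by rewrite !hornerE.
have rP a : a \in r -> a ^+ m = z.
  move=> ar; apply/eqP; rewrite -subr_eq0.
  have : root ('X^m - z%:P) a by rewrite Er lc scale1r root_prod_XsubC.
  by rewrite /root !hornerE.
(* If every root violated the bound, multiplying the [m] strict inequalities would put
   [|x ^ m - z| ^ m] strictly below itself. *)
apply: contrapT => H.
have lt_all a : a \in r -> `|x ^+ m - z| < `|x - a| ^+ m.
  move=> ar; rewrite real_ltNge ?rpredX ?normr_real //.
  apply/negP => le; apply: H; exists a; [exact: rP|by rewrite distrC].
suff : `|x ^+ m - z| ^+ m < `|x ^+ m - z| ^+ m by rewrite ltxx.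
rewrite [ltRHS](_ : _ = \prod_(a <- r) `|x - a| ^+ m); last first.
  by rewrite {1}hx normr_prod prodrXl.
rewrite -[ltLHS]mulr1 -iter_mulr -{1}sr -(count_predT r) -big_const_seq big_seq [ltRHS]big_seq.
apply: ltr_prod => [|a /lt_all ->]; last by rewrite normr_ge0.
by apply/hasP; case: (r) sr m0 => [<-|a r' _ _] //; exists a; rewrite mem_head.
Qed.

(** Picking a near root for each [k] takes the place of a continuous branch of the root, and also
    works at [x = 0]. *)
Lemma tends_root (m : nat) (x : C) (z : nat -> C) : (0 < m)%N ->
  tends z (x ^+ m) -> exists u, tends u x /\ forall k, u k ^+ m = z k.
Proof.
move=> m0 zx.
pose u k := s2val (cid2 (near_root x (z k) m0)).
have uz k : u k ^+ m = z k := s2valP (cid2 (near_root x (z k) m0)).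
have ux k : `|u k - x| ^+ m <= `|x ^+ m - z k| := s2valP' (cid2 (near_root x (z k) m0)).
exists u; split=> // e e0.
apply: eventually_sub (zx (e ^+ m) (exprn_gt0 m e0)) => k hk.
rewrite -(ltr_pXn2r m0) ?nnegrE ?normr_ge0 ?(ltW e0) //.
by apply: le_lt_trans (ux k) _; rewrite distrC.
Qed.

Lemma tends_rootz (m : int) (x : C) (z : nat -> C) : m != 0 -> x != 0 ->
  tends z (x ^ m) -> exists u, tends u x /\ forall k, u k ^ m = z k.
Proof.
case: m => m m0 x0 zx; first by apply: tends_root zx; rewrite lt0n.
have [|u [ux uz]] := @tends_root m.+1 x (fun k => (z k)^-1) isT.
  by rewrite -[x ^+ _]invrK exprnN -NegzE; apply: tendsV => //; rewrite expfz_neq0.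
by exists u; split=> // k; rewrite NegzE -exprnN uz invrK.
Qed.

Lemma rootz (m : int) (x : C) : m != 0 -> x != 0 -> exists2 y, y != 0 & y ^ m = x.
Proof.
move=> m0 x0.
(* A sequence with value [x] at index 0 and 1 afterwards tends to [1 ^ m]; the root at index 0 is
   the wanted one. *)
have [|u [_ ux]] := @tends_rootz m 1 (fun k => if k == 0%N then x else 1) m0 (oner_neq0 _).
  by apply: tends_eventually (tends_cst _); exists 1%N => -[|k]; rewrite // exp1rz.
exists (u 0%N); last exact: ux.
by apply: contraNneq x0 => u0; have := ux 0%N; rewrite /= u0 exp0rz (negPf m0) => <-.
Qed.

Lemma prim_root_exists (m : nat) : (0 < m)%N -> exists w : C, m.-primitive_root w.
Proof.
pose p : {poly C} := 'X^m - 1; have [r Dp] := closed_field_poly_normal p.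
move=> m0; rewrite (monicP _) ?monicXnsubC // scale1r in Dp.
have rn1 : all m.-unity_root r by apply/allP=> z; rewrite -root_prod_XsubC -Dp.
have sz_r : (m < (size r).+1)%N by rewrite -(size_prod_XsubC r id) -Dp size_XnsubC.
have [|z] := hasP (has_prim_root m0 rn1 _ sz_r); last by exists z.
by rewrite -separable_prod_XsubC -Dp separable_Xn_sub_1 // pnatr_eq0 -lt0n.
Qed.

End Roots.

(** The Archimedean property of [R] supplies the null sequence of non-zero parameters used for all
    curves below. *)
Lemma tends_harmonic (R : realType) : tends (fun k => (k.+1%:R)^-1 : R[i]) 0.
Proof.
move=> e e0; have ee : e = (complex.Re e)%:C%C by rewrite RRe_real ?gtr0_real.
have re0 : 0 < complex.Re e by rewrite -ltcR -ee.
exists (Num.bound (complex.Re e)^-1) => k hk; rewrite subr0 normfV normr_nat.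
rewrite invf_plt ?posrE ?ltr0n // ee -fmorphV -(rmorph_nat (real_complex R)) ltcR.
apply: lt_le_trans (archi_boundP _) _; first by rewrite invr_ge0 ltW.
by rewrite ler_nat; apply: leq_trans hk _.
Qed.

(** * Homogeneous polynomials *)

Section Homogeneous.
Variables (K : fieldType) (n : nat).
Implicit Types (p q : {mpoly K[n]}).

(** The monomial order is compatible with addition: every other pair of monomials has a strictly
    larger sum, so one term survives. *)
Lemma mlastcM p q : p != 0 -> q != 0 ->
  (p * q)@_(mlast p + mlast q) = p@_(mlast p) * q@_(mlast q).
Proof.
move=> p0 q0; rewrite mpolyME (bigD1_seq (mlast p, mlast q)) /=; first last.
- by rewrite allpairs_uniq // => -[? ?] [].
- by rewrite allpairs_f // !mlast_supp.
rewrite mcoeffD mcoeffZ mcoeffX eqxx mulr1 big_seq_cond raddf_sum /= big1 ?addr0 //.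
move=> _ /andP[/allpairsP[[m1 m2] /= [/mlast_lemc h1 /mlast_lemc h2 ->]] /= ne].
 rewrite mcoeffZ mcoeffX.
suff /gt_eqF -> : ((mlast p + mlast q)%MM < (m1 + m2)%MM)%O by rewrite mulr0.
move: h1; rewrite le_eqVlt => /predU1P[m1E|/ltmc_le_add]; last exact.
move: h2; rewrite le_eqVlt => /predU1P[m2E|/lemc_lt_add]; last by apply; rewrite m1E.
by move: ne; rewrite m1E m2E eqxx.
Qed.

(** The monomial order refines the degree, so [mlead] and [mlast] carry the largest and smallest
    degrees of each factor. Both end monomials of [p * q] have degree [d], which forces equality in
    each factor. *)
Lemma dhomog_factor d p q : p * q != 0 -> p * q \is d.-homog ->
  exists e, p \is e.-homog.
Proof.
rewrite mulf_eq0 negb_or => /andP[p0 q0] /dhomogP pq.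
have pq0 : p * q != 0 by rewrite mulf_neq0.
have := pq _ (mlead_supp pq0).
have : (mlast p + mlast q)%MM \in msupp (p * q).
  by rewrite mcoeff_msupp mlastcM // mulf_neq0 // -mcoeff_msupp mlast_supp.
rewrite mleadM // => /pq /=; rewrite !mdegD => h1 h2.
have := lemc_mdeg (mlast_lemc (mlead_supp p0)).
have := lemc_mdeg (mlast_lemc (mlead_supp q0)).
move=> hq hp; exists (mdeg (mlead p)); apply/dhomogP => m mp.
have := lemc_mdeg (mlast_lemc mp); have := lemc_mdeg (msupp_le_mlead mp).
rewrite /=; move: (mdeg m) (mdeg (mlead p)) (mdeg (mlead q)) (mdeg (mlast p)) (mdeg (mlast q)) hp hq h1 h2.
lia.
Qed.

Lemma dhomog_meval d p (c : K) (v : 'I_n -> K) : p \is d.-homog ->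
  p.@[fun i => c * v i] = c ^+ d * p.@[v].
Proof.
move=> /dhomogP hp; rewrite !mevalE mulr_sumr; apply: eq_big_seq => m mp.
rewrite mulrCA; congr (_ * _).
rewrite (eq_bigr (fun i => c ^+ m i * v i ^+ m i)) => [|i _]; last by rewrite exprMn.
by rewrite big_split /= prodrXr -mdegE hp.
Qed.

Lemma dhomog_mderiv d p i : p \is d.-homog -> p^`M(i) \is d.-1.-homog.
Proof.
move=> /dhomogP hp; apply/dhomogP => m; rewrite mcoeff_msupp mcoeff_deriv => h.
have /hp : (m + U_(i))%MM \in msupp p.
  by rewrite mcoeff_msupp; apply: contraNneq h => ->; rewrite mul0rn.
by rewrite /= mdegD mdeg1 => <-; rewrite addn1.
Qed.

Lemma dhomog_bigprod (I : Type) (r : seq I) (F : I -> {mpoly K[n]}) (d : I -> nat) :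
  (forall i, F i \is (d i).-homog) ->
  \prod_(i <- r) F i \is (\sum_(i <- r) d i)%N.-homog.
Proof.
move=> hF; elim: r => [|i r IH]; first by rewrite !big_nil dhomog1.
by rewrite !big_cons; apply: dhomogM.
Qed.

End Homogeneous.

Lemma dhomog_comp (K : fieldType) (n k d e : nat) (p : {mpoly K[n]})
    (lq : n.-tuple {mpoly K[k]}) :
  p \is d.-homog -> (forall i, tnth lq i \is e.-homog) ->
  p \mPo lq \is (d * e).-homog.
Proof.
move=> /dhomogP hp hq; rewrite comp_mpolyEX big_seq; apply: rpred_sum => m mp.
apply: rpredZ; rewrite comp_mpolyX -(hp _ mp) /= mdegE big_distrl /=.
by apply: dhomog_bigprod => i; rewrite mulnC; apply: dhomogMn.
Qed.

(* Among the homogeneous polynomials with a given zero locus, one of least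
   degree is square-free: if [f = g ^+ 2 * q] then [g * q] has the same zeros. *)
Lemma square_free_exists (R : realType) (n d : nat) (p : {mpoly R[i][n.+1]}) :
  p != 0 -> p \is d.-homog ->
  exists f, square_free_defining (zero_locus p) f.
Proof.
move=> p0 hp.
pose P (m : nat) := `[< exists f e, [/\ f != 0, f \is e.-homog,
  zero_locus f = zero_locus p & msize f = m] >].
have exP : exists m, P m by exists (msize p); apply/asboolP; exists p, d.
case: (ex_minnP exP) => m /asboolP [f [e [f0 hf zf <-]]] mmin.
exists f; split=> //; first by exists e.
move=> g q fE.
have [gq0 g0] : g * q != 0 /\ g != 0.
  by move: f0; rewrite fE expr2 -mulrA mulf_eq0 negb_or => /andP[].
have gqg : g * q * g = f by rewrite fE; ring.
have [e' hgq] : exists e', g * q \is e'.-homog.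
  by apply: (@dhomog_factor _ _ e _ g); rewrite gqg.
have : P (msize (g * q)).
  apply/asboolP; exists (g * q), e'; split=> //; rewrite -zf; apply/seteqP.
  split=> x [x0 hx]; split=> //.
    by rewrite -gqg mevalM hx mul0r.
  by apply/eqP; move/eqP: hx; rewrite fE !mevalM !mulf_eq0 orbb.
(* Minimality bounds the size of [g * q * g] by that of [g * q], leaving only [msize g = 1], a
   non-zero constant. *)
move=> /mmin; rewrite -gqg msizeM //.
have : msize g != 0%N by rewrite msize_poly_eq0.
case E : (msize g) => [//|[|k]] _; last first.
  have : msize (g * q) != 0%N by rewrite msize_poly_eq0.
  by case: (msize (g * q)) => // k' _; rewrite addnS /= addnS -addSn leqNgt ltnS leq_addr.
move=> _; have /eqP/msize_poly1P [c c0 ->] := E.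
by exists c.
Qed.

(** * Norm polynomials *)

Section NormPolynomial.
Variable K : fieldType.

Definition mscale n (c : 'I_n -> K) (p : {mpoly K[n]}) : {mpoly K[n]} :=
  p \mPo [tuple c i *: 'X_i | i < n].

Lemma mcoeff_mscale n c (p : {mpoly K[n]}) m :
  (mscale c p)@_m = p@_m * \prod_i c i ^+ m i.
Proof.
have X m' : 'X_[m'] \mPo [tuple c i *: 'X_i | i < n] = (\prod_i c i ^+ m' i) *: 'X_[m'].
  rewrite comp_mpolyX -mul_mpolyC rmorph_prod /= mpolyXE_id -big_split.
  apply: eq_bigr => i _.
  by rewrite tnth_mktuple exprZn -mul_mpolyC.
rewrite /mscale comp_mpolyEX raddf_sum /=.
rewrite (eq_bigr (fun m' => p@_m' * \prod_i c i ^+ m' i * (m' == m)%:R)); last first.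
  by move=> m' _; rewrite X !mcoeffZ mcoeffX mulrA.
have [mp|mp] := boolP (m \in msupp p).
  rewrite (bigD1_seq m) ?msupp_uniq //= eqxx mulr1 [X in _ + X]big1 ?addr0 // => m' /negPf ->.
  by rewrite mulr0.
rewrite (memN_msupp_eq0 mp) mul0r big_seq big1 // => m' m'p.
by rewrite (negPf (memPn mp _ m'p)) mulr0.
Qed.

Lemma meval_mscale n c (p : {mpoly K[n]}) v :
  (mscale c p).@[v] = p.@[fun i => c i * v i].
Proof.
rewrite comp_mpoly_meval; apply: meval_eq => i.
by rewrite tnth_mktuple mevalZ mevalXU.
Qed.

Lemma eq_mscale n c c' (p : {mpoly K[n]}) : c =1 c' -> mscale c p = mscale c' p.
Proof.
move=> cc; apply/mpolyP => m; rewrite !mcoeff_mscale.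
by congr (_ * _); apply: eq_bigr => i _; rewrite cc.
Qed.

Lemma mscaleM n c c' (p : {mpoly K[n]}) :
  mscale c (mscale c' p) = mscale (fun i => c i * c' i) p.
Proof.
apply/mpolyP => m; rewrite !mcoeff_mscale -mulrA -big_split.
by congr (_ * _); apply: eq_bigr => i _; rewrite exprMn mulrC.
Qed.

Lemma dhomog_mscale n c d (p : {mpoly K[n]}) :
  p \is d.-homog -> mscale c p \is d.-homog.
Proof.
move=> hp; rewrite -[d]muln1; apply: dhomog_comp hp _ => i.
by rewrite tnth_mktuple; apply: rpredZ; rewrite dhomogX /= mdeg1.
Qed.

Variables (n r : nat) (w : K).
Hypothesis w_prim : r.-primitive_root w.

(** The coordinate at [ord0] is normalised to 1, since a common root of unity only rescales a
    homogeneous polynomial. Otherwise, for [r > 1], the trivial twist would recur up to scalars and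
    the gradient of the norm would vanish on the branch. *)
Definition zeta (e : {ffun 'I_n -> 'I_r}) (i : 'I_n.+1) : K :=
  if unlift ord0 i is Some j then w ^+ e j else 1.

Lemma zeta_expr e i : zeta e i ^+ r = 1.
Proof.
rewrite /zeta; case: unlift => [j|]; last exact: expr1n.
by rewrite exprAC (prim_expr_order w_prim) expr1n.
Qed.

Lemma zeta_neq0 e i : zeta e i != 0.
Proof.
rewrite /zeta; case: unlift => [j|]; last exact: oner_neq0.
by rewrite expf_neq0 // (prim_root_eq0 w_prim) -lt0n (prim_order_gt0 w_prim).
Qed.

(** Multiplying one coordinate by [w] shifts one exponent cyclically, which merely permutes the
    factors. *)
Lemma mscale_zeta_prod (f : {mpoly K[n.+1]}) (j : 'I_n) :
  let P := \prod_e mscale (zeta e) f in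
  mscale (fun i => if i == lift ord0 j then w else 1) P = P.
Proof.
move=> P; rewrite {1}/P /mscale rmorph_prod /= /P.
pose sh (e : {ffun 'I_n -> 'I_r}) := [ffun k => if k == j then ordS (e k) else e k].
have sh_bij : bijective sh.
  exists (fun e : {ffun 'I_n -> 'I_r} => [ffun k => if k == j then ord_pred (e k) else e k]).
    by move=> e; apply/ffunP => k; rewrite !ffunE; case: eqP => // _; rewrite ordSK.
  by move=> e; apply/ffunP => k; rewrite !ffunE; case: eqP => // _; rewrite ord_predK.
rewrite [RHS](reindex sh) /=; last exact: onW_bij.
apply: eq_bigr => e _; rewrite -!/(mscale _ _) mscaleM; apply: eq_mscale => i.
rewrite /zeta; case: unliftP => [k ->|->]; last by rewrite mulr1.
rewrite (inj_eq lift_inj) ffunE; case: ifP => _; last by rewrite mul1r.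
by rewrite /= (prim_expr_mod w_prim) exprS.
Qed.

(* The product over the twists [f (zeta x)] only involves the powers [x_i ^+ r],
   since it is invariant under multiplying [x_i], [i > 0], by [w]; for [x_0] the
   divisibility of the exponent follows from homogeneity. *)
Lemma norm_polynomial (d : nat) (f : {mpoly K[n.+1]}) : (0 < n)%N -> f \is d.-homog ->
  exists N D, N \is D.-homog /\ forall x : 'I_n.+1 -> K,
    N.@[fun i => x i ^+ r] = \prod_e f.@[fun i => zeta e i * x i].
Proof.
move=> n0 hf; pose P := \prod_e mscale (zeta e) f.
have r0 := prim_order_gt0 w_prim.
have hP : P \is (r ^ n * d).-homog.
  rewrite -[r in (r ^ n)%N]card_ord -[n in (_ ^ n)%N]card_ord -card_ffun -sum_nat_const.
  by apply: dhomog_bigprod => e; apply: dhomog_mscale.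
have dvd_lift m j : m \in msupp P -> (r %| m (lift ord0 j))%N.
  rewrite mcoeff_msupp => mP; rewrite (prim_order_dvd w_prim).
  have /(congr1 (mcoeff m)) := mscale_zeta_prod f j; rewrite mcoeff_mscale -/P.
  rewrite (bigD1 (lift ord0 j)) //= eqxx big1 ?mulr1 => [|i /negPf ->]; last by rewrite expr1n.
  by rewrite -[RHS]mulr1 => /(mulfI mP)/eqP.
have dvdP m i : m \in msupp P -> (r %| m i)%N.
  move=> mP; case: (unliftP ord0 i) => [j ->|->]; first exact: dvd_lift.
  (* The total degree [r ^ n * d] is a multiple of [r] because [n > 0], and so are all exponents but
     that of [ord0]. *)
  have := dhomog_mf hP mP; rewrite /= mdegE big_ord_recl => /eqP.
  rewrite -(@dvdn_addl (\sum_(j < n) m (lift ord0 j))%N _ (m ord0)) => [/eqP ->|].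
    by rewrite dvdn_mulr // dvdn_exp.
  by apply: dvdn_sum => j _; exact: dvd_lift.
pose q (m : 'X_{1..n.+1}) := [multinom (m i %/ r)%N | i < n.+1].
exists (\sum_(m <- msupp P) P@_m *: 'X_[q m]), ((r ^ n * d) %/ r)%N; split.
  rewrite big_seq; apply: rpred_sum => m mP; apply: rpredZ.
  rewrite dhomogX /= -(dhomog_mf hP mP) /= !mdegE.
  rewrite [X in (X %/ r)%N](eq_bigr (fun i => q m i * r)%N) => [|i _].
    by rewrite -big_distrl mulnK.
  by rewrite mnmE divnK // dvdP.
move=> x; rewrite raddf_sum /= -[RHS](_ : P.@[x] = _); last first.
  by rewrite rmorph_prod; apply: eq_bigr => e _; rewrite /= meval_mscale.
rewrite mevalE big_seq [RHS]big_seq; apply: eq_bigr => m mP.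
rewrite mevalZ mevalX; congr (_ * _); apply: eq_bigr => i _.
by rewrite mnmE -exprM mulnC divnK // dvdP.
Qed.

End NormPolynomial.

(** * Branches *)

Section Branches.
Variables (R : realType) (n : nat).
Local Notation C := R[i].
Local Notation vec := 'rV[C]_n.+1.
Local Notation pol := {mpoly C[n.+1]}.
Implicit Types (x y u v : vec) (A B : set vec) (s r : int).

Lemma zariski_closure_sub A B :
  A `<=` zariski_closure B -> zariski_closure A `<=` zariski_closure B.
Proof.
move=> AB y [y0 hy]; split=> // d f hf fB; apply: (hy d f hf) => x /AB[_ hx].
exact: hx hf fB.
Qed.

Lemma sub_zariski_closure A : (forall x, A x -> x != 0) -> A `<=` zariski_closure A.
Proof. by move=> A0 x Ax; split=> [|d f _ fA]; [exact: A0|exact: fA]. Qed.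

Lemma torus_neq0 x : in_torus x -> x != 0.
Proof. by move=> /(_ ord0); apply: contraNneq => ->; rewrite mxE. Qed.

Lemma pow_map_torus r x : in_torus x -> in_torus (pow_map r x).
Proof. by move=> tx i; rewrite mxE expfz_neq0. Qed.

Lemma vec_rootz r x : r != 0 -> in_torus x -> exists2 u, in_torus u & pow_map r u = x.
Proof.
move=> r0 tx; pose a i := cid2 (rootz r0 (tx i)).
exists (\row_i s2val (a i)) => [i|]; first by rewrite mxE; exact: (s2valP (a i)).
by apply/rowP => i; rewrite !mxE; exact: (s2valP' (a i)).
Qed.

Lemma pow_mapM r r' x : pow_map (r * r') x = pow_map r' (pow_map r x).
Proof. by apply/rowP => i; rewrite !mxE exprz_exp. Qed.

(* A single-valued parametrization of [\sum_i y_i ^ (s / r) = 0] on the torus. *)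
Definition branch s r : set vec :=
  [set y | exists u, [/\ in_torus u, \sum_i u 0 i ^ s = 0 & y = pow_map r u]].

Lemma branch_torus s r y : branch s r y -> in_torus y.
Proof. by move=> [u [tu _ ->]]; exact: pow_map_torus. Qed.

Lemma branch_neq0 s r y : branch s r y -> y != 0.
Proof. by move=> /branch_torus/torus_neq0. Qed.

Lemma branch_scale s r c y : r != 0 -> c != 0 -> branch s r y -> branch s r (c *: y).
Proof.
move=> r0 c0 [u [tu su ->]]; have [b b0 bc] := rootz r0 c0.
exists (b *: u); split.
- by move=> i; rewrite mxE mulf_neq0.
- rewrite (eq_bigr (fun i => b ^ s * u 0 i ^ s)) => [|i _].
    by rewrite -mulr_sumr su mulr0.
  by rewrite mxE expfzMl.
- by apply/rowP => i; rewrite !mxE expfzMl bc.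
Qed.

Lemma branch_mulz m s r : m != 0 -> branch (m * s) (m * r) = branch s r.
Proof.
move=> m0; apply/seteqP; split=> _ [u [tu su ->]].
  exists (pow_map m u); split; [exact: pow_map_torus| |exact: pow_mapM].
  by rewrite -[RHS]su; apply: eq_bigr => i _; rewrite mxE exprz_exp.
have [v tv vu] := vec_rootz m0 tu; exists v; split=> //; last by rewrite pow_mapM vu.
by rewrite -[RHS]su; apply: eq_bigr => i _; rewrite -vu mxE exprz_exp.
Qed.

(** Scaling the first pair by [s'] and the second by [s] yields the same pair. *)
Lemma branch_ratio s r s' r' : s != 0 -> s' != 0 -> s * r' = s' * r ->
  branch s r = branch s' r'.
Proof.
move=> s0 s'0 e; rewrite -(branch_mulz s r s'0) -(branch_mulz s' r' s0).
by rewrite e mulrC.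
Qed.

(** * Values of power sums *)

Lemma power_sum_gt0E s (v : 'I_n.+1 -> C) : 0 < s ->
  (power_sum R n s).@[v] = \sum_i v i ^ s.
Proof.
case: s => [[|m]|m] // _; rewrite /power_sum /= raddf_sum.
by apply: eq_bigr => i _; rewrite /= rmorphXn /= mevalXU.
Qed.

Lemma power_sum_lt0E s (v : 'I_n.+1 -> C) : s < 0 ->
  (power_sum R n s).@[v] = \sum_i \prod_(j | j != i) v j ^+ `|s|%N.
Proof.
case: s => [//|m] _; rewrite /power_sum /= raddf_sum.
apply: eq_bigr => i _; rewrite /= rmorph_prod; apply: eq_bigr => j _.
by rewrite /= rmorphXn /= mevalXU.
Qed.

(** The factor clearing denominators between [\sum_i v_i ^ s] and the polynomial [power_sum] when
    [s < 0]. *)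
Definition torus_unit s (v : 'I_n.+1 -> C) : C :=
  if 0 < s then 1 else \prod_i v i ^+ `|s|%N.

Lemma torus_unit_neq0 s (v : 'I_n.+1 -> C) : (forall i, v i != 0) -> torus_unit s v != 0.
Proof.
move=> v0; rewrite /torus_unit; case: ifP => _; first exact: oner_neq0.
by apply/prodf_neq0 => i _; rewrite expf_neq0.
Qed.

Lemma power_sum_torusE s (v : 'I_n.+1 -> C) : s != 0 -> (forall i, v i != 0) ->
  (power_sum R n s).@[v] = torus_unit s v * \sum_i v i ^ s.
Proof.
move=> s0 v0; rewrite /torus_unit; case: ifP => hs; first by rewrite mul1r power_sum_gt0E.
have sn : s < 0 by lia.
rewrite power_sum_lt0E // mulr_sumr; apply: eq_bigr => i _.
rewrite [in RHS](bigD1 i) //= mulrAC.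
have -> : v i ^ s = (v i ^+ `|s|%N)^-1 by rewrite exprnN; congr (_ ^ _); lia.
by rewrite divff ?mul1r // expf_neq0.
Qed.

Lemma power_sum_torus0 s u : s != 0 -> in_torus u ->
  (power_sum R n s).@[u 0] = 0 <-> \sum_i u 0 i ^ s = 0.
Proof.
move=> s0 tu; rewrite power_sum_torusE //; split=> [/eqP|->]; last by rewrite mulr0.
by rewrite mulf_eq0 (negPf (torus_unit_neq0 s tu)) => /eqP.
Qed.

Lemma power_sum_homog s : exists d, power_sum R n s \is d.-homog.
Proof.
rewrite /power_sum; case: ifP => _; first by exists 0%N; exact: dhomog1.
have hX (j : 'I_n.+1) : ('X_j ^+ `|s|%N : pol) \is `|s|%N.-homog.
  by rewrite -[X in X.-homog]mul1n; apply: dhomogMn; rewrite dhomogX /= mdeg1.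
case: ifP => _; first by exists `|s|%N; apply: rpred_sum => i _.
exists (n * `|s|)%N; apply: rpred_sum => i _; rewrite big_mkcond /=.
rewrite (_ : (n * _)%N = (\sum_(j < n.+1) if j != i then `|s| else 0)%N); last first.
  by rewrite -big_mkcond sum_nat_const cardC1 card_ord.
by apply: dhomog_bigprod => j; case: ifP => _ //; exact: dhomog1.
Qed.

(** Makes the norm polynomial non-zero. The point is a coordinate point for [s > 0], and has a
    single zero coordinate for [s < 0]; in both cases exactly one summand survives. *)
Lemma power_sum_twist_neq0 s : s != 0 -> exists x,
  forall c : 'I_n.+1 -> C, (forall i, c i != 0) ->
    (power_sum R n s).@[fun i => c i * x 0 i] != 0.
Proof.
move=> s0; have [sp|sn] : 0 < s \/ s < 0 by lia.
  exists (\row_i (i == ord0)%:R) => c c0.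
  rewrite power_sum_gt0E // (bigD1 ord0) //= big1 => [|i /negPf i0].
    by rewrite mxE eqxx mulr1 addr0 expfz_neq0.
  by rewrite mxE i0 mulr0 exp0rz (negPf s0).
exists (\row_i (i != ord0)%:R) => c c0.
rewrite power_sum_lt0E // (bigD1 ord0) //= [X in _ + X]big1 => [|i i0].
  rewrite addr0; apply/prodf_neq0 => j j0.
  by rewrite expf_neq0 // mxE j0 mulr1.
rewrite (bigD1 ord0) 1?eq_sym //= mxE eqxx mulr0 expr0n.
by rewrite absz_eq0 (negPf s0) mul0r.
Qed.

(** * Density of torus points among the zeros of a power sum *)

Variable t : nat -> C.
Hypothesis t_neq0 : forall k, t k != 0.
Hypothesis t_tends0 : tends t 0.

Lemma affine_neq0 (a b : C) : (a != 0) || (b != 0) -> eventually (fun k => a + t k * b != 0).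
Proof.
have [->|a0 _] := eqVneq a 0.
  by move=> /= b0; exists 0%N => k _; rewrite add0r mulf_neq0.
apply: tends_neq0 a0; rewrite -[X in tends _ X]addr0 -[X in _ + X](mul0r b).
exact: tendsD (tends_cst a) (tendsM t_tends0 (tends_cst b)).
Qed.

(** In the variables [z_i = x_i ^ |s|] the equation on the torus reads [\sum_i z_i = 0] or
    [\sum_i 1 / z_i = 0]. The perturbation is made there and carried back by roots close to [x]. *)
Lemma power_sum_dense s x : (0 < n)%N -> s != 0 -> (power_sum R n s).@[x 0] = 0 ->
  exists u : nat -> vec,
    eventually (fun k => in_torus (u k) /\ \sum_i u k 0 i ^ s = 0) /\
    forall i, tends (fun k => u k 0 i) (x 0 i).
Proof.
move=> n0 s0 fx.
have main (z : 'I_n.+1 -> nat -> C) : (forall i, tends (z i) (x 0 i ^+ `|s|%N)) ->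
    (forall i, eventually (fun k => z i k != 0)) ->
    eventually (fun k => \sum_i z i k ^ Num.sg s = 0) ->
    exists u : nat -> vec,
    eventually (fun k => in_torus (u k) /\ \sum_i u k 0 i ^ s = 0) /\
    forall i, tends (fun k => u k 0 i) (x 0 i).
  move=> zx znz zsum; have s1 : (0 < `|s|)%N by rewrite absz_gt0.
  pose a i := cid (tends_root s1 (zx i)).
  have az i k : projT1 (a i) k ^+ `|s|%N = z i k := (projT2 (a i)).2 k.
  exists (fun k => \row_i projT1 (a i) k); split; last first.
    by move=> i; apply: eq_tends (projT2 (a i)).1 => k; rewrite mxE.
  apply: eventually_sub (eventuallyI (eventually_fin znz) zsum) => k [h1 h2].
  split=> [i|]; first by apply: contraNneq (h1 i); rewrite mxE -az => ->; rewrite expr0n eqn0Ngt s1.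
  rewrite -[RHS]h2; apply: eq_bigr => i _.
  by rewrite mxE -az exprnP exprz_exp mulrC -intEsg.
have [sp|sn] : 0 < s \/ s < 0 by lia.
  (* A direction of sum zero with no zero coordinate, as [n > 0]. *)
  pose w (i : 'I_n.+1) : C := if i == ord0 then - n%:R else 1.
  have w_sum : \sum_i w i = 0.
    rewrite (bigD1 ord0) //= (eq_bigr (fun=> 1)) => [|i /negPf i0]; last by rewrite /w i0.
    by rewrite sumr_const cardC1 card_ord addNr.
  apply: (main (fun i k => x 0 i ^+ `|s|%N + t k * w i)) => [i|i|].
  - rewrite -[X in tends _ X]addr0 -[X in _ + X](mul0r (w i)).
    exact: tendsD (tends_cst _) (tendsM t_tends0 (tends_cst _)).
  - apply: affine_neq0; rewrite orbC /w; case: ifP; rewrite ?oner_neq0 //.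
    by rewrite oppr_eq0 pnatr_eq0 -lt0n n0.
  - exists 0%N => k _; rewrite gtr0_sg //.
    under eq_bigr do rewrite expr1z.
    rewrite big_split -mulr_sumr /= w_sum mulr0 addr0.
    rewrite -[RHS]fx power_sum_gt0E //; apply: eq_bigr => i _.
    by rewrite exprnP; congr (_ ^ _); lia.
have [/forallP tx|] := boolP [forall i, x 0 i != 0].
  exists (fun=> x); split; last by move=> i; exact: tends_cst.
  by exists 0%N => k _; split=> //; exact/power_sum_torus0.
rewrite negb_forall => /existsP[i0]; rewrite negbK => /eqP x0.
have s1 : (`|s|%N == 0%N) = false by apply/negbTE; rewrite absz_eq0.
(* The zero at [i0] kills every summand except the one omitting [i0], so a second coordinate [i1]
   must vanish. *)
have : \prod_(j | j != i0) x 0 j ^+ `|s|%N = 0.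
  rewrite -[RHS]fx power_sum_lt0E // [RHS](bigD1 i0) //= [X in _ + X]big1 ?addr0 // => i ii0.
  by rewrite (bigD1 i0) 1?eq_sym //= x0 expr0n s1 /= mulr0n mul0r.
move=> /eqP/prodf_eq0[i1 i10]; rewrite expf_eq0 => /andP[_ /eqP x1].
pose z i k := if x 0 i == 0 then t k else x 0 i ^+ `|s|%N.
have ztends i : tends (z i) (x 0 i ^+ `|s|%N).
  rewrite /z; case: eqP => [->|_]; last exact: tends_cst.
  by rewrite expr0n s1; exact: t_tends0.
have z_neq0 i k : z i k != 0.
  by rewrite /z; case: ifP => [_|/negbT xi0]; [exact: t_neq0|rewrite expf_neq0].
pose S k := \sum_(i | i != i1) (z i k)^-1.
pose c i : C := if x 0 i == 0 then 1 else 0.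
have tS : tends (fun k => t k * S k) (\sum_(i | i != i1) c i).
  apply: (@eq_tends _ (fun k => \sum_(i | i != i1) t k * (z i k)^-1)).
    by move=> k; rewrite mulr_sumr.
  apply: tends_sum => i; rewrite /z /c; case: eqP => [_|_].
    by apply: eq_tends (tends_cst 1) => k; rewrite divff.
  by rewrite -(mul0r (x 0 i ^+ `|s|%N)^-1); exact: tendsM t_tends0 (tends_cst _).
have c0 : \sum_(i | i != i1) c i != 0.
  rewrite (bigD1 i0) /= ?[i0 == _]eq_sym // /c x0 eqxx; apply/lt0r_neq0.
  by apply: ltr_pwDl => //; apply: sumr_ge0 => i _; case: ifP.
(* The entry at [i1] is [- 1 / S k], solved from [\sum_i 1 / z'_i = 0]. It tends to 0 because
   [t k * S k] tends to the number of zero coordinates other than [i1], positive thanks to [i0]. *)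
pose z' i k := if i == i1 then - (t k / (t k * S k)) else z i k.
have tSn := tends_neq0 tS c0.
apply: (main z') => [i|i|].
- rewrite /z'; case: eqP => [->|_] //; rewrite x1 expr0n s1.
  by rewrite -[X in tends _ X]oppr0 -(mul0r (\sum_(i | i != i1) c i)^-1);
    exact/tendsN/tendsM/tendsV.
- rewrite /z'; case: eqP => [_|_]; last by exists 0%N => k _.
  by apply: eventually_sub tSn => k h; rewrite oppr_eq0 mulf_neq0 ?invr_eq0.
- apply: eventually_sub tSn => k h; rewrite ltr0_sg // (bigD1 i1) //= /z' eqxx.
  rewrite (eq_bigr (fun i => (z i k)^-1)) => [|i /negPf ->]; last by rewrite exprN1.
  rewrite exprN1 -/(S k); move: h; rewrite mulf_eq0 negb_or => /andP[h1 h2].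
  by field; rewrite h1 h2.
Qed.

End Branches.

(** * Closures of branches *)

Section Closures.
Variables (R : realType) (n : nat).
Hypothesis n_gt0 : (0 < n)%N.
Local Notation C := R[i].
Local Notation vec := 'rV[C]_n.+1.
Local Notation pol := {mpoly C[n.+1]}.
Implicit Types (x y u v : vec) (A B : set vec) (s r : int).

Lemma dhomog_mevalZ d (f : pol) c x : f \is d.-homog ->
  f.@[(c *: x) 0] = c ^+ d * f.@[x 0].
Proof.
by move=> hf; rewrite -(dhomog_meval _ _ hf); apply: meval_eq => i; rewrite mxE.
Qed.

Lemma harmonic_neq0 k : (k.+1%:R)^-1 != 0 :> C.
Proof. by rewrite invr_eq0 pnatr_eq0. Qed.

(** * The norm of a power sum *)

Section Norm.
Variables (s : int) (r : nat) (w : C).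
Hypotheses (s_neq0 : s != 0) (w_prim : r.-primitive_root w).

Lemma zeta0 (r0 : (0 < r)%N) (i : 'I_n.+1) : zeta w [ffun=> Ordinal r0] i = 1 :> C.
Proof. by rewrite /zeta; case: unlift => // j; rewrite ffunE. Qed.

Lemma power_sum_norm : exists (N : pol) D, [/\ N != 0, N \is D.-homog &
  forall x, N.@[(pow_map r x) 0] =
    \prod_(e : {ffun 'I_n -> 'I_r}) (power_sum R n s).@[fun i => zeta w e i * x 0 i]].
Proof.
have [d hf] := power_sum_homog R n s.
have [N [D [hN NE]]] := norm_polynomial w_prim n_gt0 hf.
have NE' x : N.@[(pow_map r x) 0] =
    \prod_(e : {ffun 'I_n -> 'I_r}) (power_sum R n s).@[fun i => zeta w e i * x 0 i].
  by rewrite -NE; apply: meval_eq => i; rewrite mxE.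
exists N, D; split=> //; have [x hx] := power_sum_twist_neq0 R n s_neq0.
apply: contra_neq (oner_neq0 C) => N0; have := NE' x; rewrite N0 meval0 => /esym/eqP/prodf_eq0.
by move=> [e _ /eqP h]; move: (hx (zeta w e) (zeta_neq0 w_prim e)); rewrite h eqxx.
Qed.

(** A zero of [N] at [x ^ r] kills some twist; absorbing its roots of unity into [x] gives a zero of
    the power sum with the same [r]-th power. *)
Lemma norm_zero_locus (N : pol) D : N \is D.-homog ->
  (forall x, N.@[(pow_map r x) 0] =
    \prod_(e : {ffun 'I_n -> 'I_r}) (power_sum R n s).@[fun i => zeta w e i * x 0 i]) ->
  zero_locus N = pow_image r (zero_locus (power_sum R n s)).
Proof.
move=> hN NE; have r0 := prim_order_gt0 w_prim; have [d hf] := power_sum_homog R n s.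
apply/seteqP; split=> y.
  move=> [y0 Ny].
  (* Only the existence of an [r]-th root is used, zero coordinates included. *)
  pose a i := cid2 (near_root 0 (y 0 i) r0).
  pose x : vec := \row_i s2val (a i).
  have xy : pow_map r x = y by apply/rowP => i; rewrite !mxE; exact: (s2valP (a i)).
  have := NE x; rewrite xy Ny => /esym/eqP/prodf_eq0 [e _ /eqP fe].
  pose x' : vec := \row_i (zeta w e i * x 0 i).
  have x'y : pow_map r x' = y.
    by rewrite -xy; apply/rowP => i; rewrite !mxE -!exprnP exprMn (zeta_expr w_prim) mul1r.
  exists x', 1; rewrite x'y scale1r oner_neq0; split=> //; split.
    apply: contraNneq y0 => x'0; rewrite -x'y x'0; apply/eqP/rowP => i.
    by rewrite !mxE -exprnP expr0n eqn0Ngt r0.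
  by rewrite -[RHS]fe; apply: meval_eq => i; rewrite mxE.
move=> [x [c [[x0 fx] c0 ->]]]; split.
  apply: contraNneq x0 => /rowP h; apply/eqP/rowP => i; move: (h i); rewrite !mxE -exprnP.
  by move=> /eqP; rewrite mulf_eq0 (negPf c0) expf_eq0 r0 => /eqP.
rewrite (dhomog_mevalZ _ _ hN) NE (bigD1 [ffun=> Ordinal r0]) //=.
rewrite (meval_eq (v2 := x 0)) ?fx ?mul0r ?mulr0 // => i.
by rewrite zeta0 mul1r.
Qed.

End Norm.

Lemma pow_image_torus s r : s != 0 -> r != 0 ->
  pow_image r [set x : vec | zero_locus (power_sum R n s) x /\ in_torus x] = branch s r.
Proof.
move=> s0 r0; apply/seteqP; split=> y.
  move=> [x [c [[[_ fx] tx] c0 ->]]]; apply: branch_scale => //.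
  by exists x; split=> //; exact/power_sum_torus0.
move=> [u [tu su ->]]; exists u, 1; rewrite scale1r oner_neq0; split=> //; split=> //.
by split; [exact: torus_neq0|exact/power_sum_torus0].
Qed.

(** The left side is closed, being the zero locus of the norm, and contains the branch. Conversely,
    by [power_sum_dense], each of its points is up to scale a limit of branch points. *)
Lemma pow_image_closure s (r : nat) : s != 0 -> (0 < r)%N ->
  pow_image r (zero_locus (power_sum R n s)) = zariski_closure (branch s r).
Proof.
move=> s0 r0; have [w w_prim] := prim_root_exists C r0.
have [N [D [_ hN NE]]] := power_sum_norm s0 w_prim.
have NZ := norm_zero_locus w_prim hN NE.
have rz : (r : int) != 0 by lia.
apply/seteqP; split=> y.
  rewrite -{1}NZ => -[y0 Ny]; split=> // d f hf fB.
  have : zero_locus N y by [].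
  rewrite NZ => -[x [c [[x0 fx] c0 ->]]]; rewrite (dhomog_mevalZ _ _ hf).
  have [u [hu ux]] := power_sum_dense harmonic_neq0 (@tends_harmonic R) n_gt0 s0 fx.
  apply/eqP; rewrite mulf_eq0; apply/orP; right; apply/eqP.
  apply: (@tends_uniq _ (fun k => f.@[(pow_map r (u k)) 0])).
    apply: tends_meval => i; rewrite mxE.
    by apply: eq_tends (tendsX r (ux i)) => k; rewrite mxE.
  apply: tends_eventually (tends_cst 0); apply: eventually_sub hu => k [tk sk].
  by rewrite fB //; exists (u k).
move=> [y0 hy]; rewrite -NZ; split=> //; apply: (hy _ _ hN) => z.
rewrite -pow_image_torus // => -[x [c [[fx _] c0 zE]]].
have : pow_image r (zero_locus (power_sum R n s)) z by exists x, c.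
by rewrite -NZ => -[].
Qed.

Lemma coord_pow_closure s r : s != 0 -> r != 0 ->
  coord_pow r (zero_locus (power_sum R n s)) = zariski_closure (branch s r).
Proof.
move=> s0 r0; rewrite /coord_pow; case: ifP => hr; last by rewrite pow_image_torus.
by case: r r0 hr => // r r0 hr; rewrite pow_image_closure // lt0n.
Qed.

(** For [r > 0] a torus point of the closure is a multiple of some [x ^ r] with [x] itself in the
    torus. Negative [r] is reached by negating both parameters. *)
Lemma closure_branch_torus s r : s != 0 -> r != 0 ->
  [set y : vec | zariski_closure (branch s r) y /\ in_torus y] = branch s r.
Proof.
have pos (s' : int) (r' : nat) : s' != 0 -> (0 < r')%N ->
    [set y : vec | zariski_closure (branch s' r') y /\ in_torus y] = branch s' r'.
  move=> s0 r0; apply/seteqP; split=> y; last first.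
    move=> By; split; last exact: branch_torus By.
    by apply: sub_zariski_closure By; exact: branch_neq0.
  rewrite /= -pow_image_closure // => -[[x [c [[x0 fx] c0 yE]]] ty].
  have rz : (r' : int) != 0 by lia.
  rewrite -pow_image_torus //.
  exists x, c; split=> //; split=> // i.
  by have := ty i; rewrite yE !mxE -exprnP mulf_eq0 negb_or expf_eq0 r0 => /andP[].
move=> s0; case: r => r r0; first by apply: pos; rewrite // lt0n.
rewrite -(@branch_mulz R n (-1)) // !mulN1r NegzE opprK; apply: pos => //.
by rewrite oppr_eq0.
Qed.

Lemma reciprocal_closure s r : s != 0 -> r != 0 ->
  reciprocal (zariski_closure (branch s r)) = zariski_closure (@branch R n s (- r)).
Proof.
move=> s0 r0; rewrite /reciprocal /coord_pow /= closure_branch_torus //.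
congr zariski_closure; apply/seteqP; split=> y.
  move=> [x [c [[u [tu su ->]] c0 ->]]]; apply: branch_scale; rewrite ?oppr_eq0 //.
  by exists u; split=> //; rewrite -[- r]mulrN1 pow_mapM.
move=> [u [tu su ->]]; exists (pow_map r u), 1.
rewrite oner_neq0 scale1r -pow_mapM mulrN1; split=> //.
by exists u.
Qed.

End Closures.

(** * Tangent spaces *)

Section Duals.
Variables (R : realType) (n : nat).
Local Notation C := R[i].
Local Notation vec := 'rV[C]_n.+1.
Local Notation pol := {mpoly C[n.+1]}.
Implicit Types (x y u v : vec) (A B : set vec) (s r : int).

Let t k : C := (k.+1%:R)^-1.
Let t_neq0 k : t k != 0 := harmonic_neq0 R k.
Let t_tends0 : tends t 0 := @tends_harmonic R.

(** A direction of coordinate sum zero: moving the [s]-th powers along it stays on the branch. *)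
Definition transfer (i j l : 'I_n.+1) : C := (l == i)%:R - (l == j)%:R.

Lemma sum_transfer (a : 'I_n.+1 -> C) i j : \sum_l a l * transfer i j l = a i - a j.
Proof.
have delta i' : \sum_l a l * (l == i')%:R = a i'.
  rewrite (bigD1 i') //= eqxx mulr1 big1 ?addr0 // => l /negPf ->.
  by rewrite mulr0.
by rewrite -(delta i) -(delta j) -sumrB; apply: eq_bigr => l _; rewrite -mulrBr.
Qed.

Lemma tends_affine (a b : C) : tends (fun k => a + t k * b) a.
Proof.
rewrite -[X in tends _ X]addr0 -[X in _ + X](mul0r b).
exact: tendsD (tends_cst _) (tendsM t_tends0 (tends_cst _)).
Qed.

(** Move [u ^ m] along [transfer i j], take nearby [m]-th roots [q], and differentiate
    [f (q ^ r) = 0]: up to the factor [r / m], the chain rule gives the difference of the two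
    sides. *)
Lemma gradient_transfer (m : nat) r u (f : pol) i j : (0 < m)%N -> r != 0 ->
  in_torus u -> \sum_l u 0 l ^ m = 0 -> vanishes_on (branch m%:Z r) f ->
  (f^`M(i)).@[(pow_map r u) 0] * u 0 i ^ (r - m%:Z) =
  (f^`M(j)).@[(pow_map r u) 0] * u 0 j ^ (r - m%:Z).
Proof.
move=> m0 r0 tu su fB.
pose a l := cid (tends_root m0 (tends_affine (u 0 l ^+ m) (transfer i j l))).
pose q k : vec := \row_l projT1 (a l) k.
have qu l : tends (fun k => q k 0 l) (u 0 l).
  by apply: eq_tends (projT2 (a l)).1 => k; rewrite mxE.
have qE k l : q k 0 l ^+ m = u 0 l ^+ m + t k * transfer i j l.
  by rewrite mxE; exact: (projT2 (a l)).2.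
have dq l : dtends t (fun k => q k 0 l) (u 0 l)
    (transfer i j l / (m%:R * u 0 l ^+ m.-1)).
  apply: (dtends_root (tu l) m0 (qu l)).
  by apply: eq_dtends (dtends_lin t_neq0 (u 0 l ^+ m) (transfer i j l)) => k.
have := dtends_meval t_neq0 t_tends0 f (fun l => dtends_exprz t_neq0 t_tends0 r (tu l) (dq l)).
set L := \sum_l _ => hL.
have L0 : L = 0.
  apply: tends_uniq hL _; apply: tends_eventually (tends_cst 0).
  apply: eventually_sub (eventually_fin (fun l => tends_neq0 (qu l) (tu l))) => k tq.
  have fq : f.@[fun l => q k 0 l ^ r] = 0.
    rewrite -(fB (pow_map r (q k))); first by apply: meval_eq => l; rewrite [RHS]mxE.
    exists (q k); split=> //.
    rewrite (eq_bigr (fun l => u 0 l ^ m + t k * transfer i j l)) => [|l _]; last first.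
      by rewrite -!exprnP qE.
    rewrite big_split /= su add0r -mulr_sumr (eq_bigr (fun l => 1 * transfer i j l)).
      by rewrite (sum_transfer (fun=> 1)) subrr mulr0.
    by move=> l _; rewrite mul1r.
  have fu : f.@[fun l => u 0 l ^ r] = 0.
    rewrite -(fB (pow_map r u)); first by apply: meval_eq => l; rewrite mxE.
    by exists u.
  by rewrite fq fu subrr mul0r.
have mC : m%:R != 0 :> C by rewrite pnatr_eq0 -lt0n.
have rC : r%:~R != 0 :> C by rewrite intr_eq0.
have LE : L = \sum_l ((f^`M(l)).@[(pow_map r u) 0] * u 0 l ^ (r - m%:Z) * (r%:~R / m%:R)) * transfer i j l.
  apply: eq_bigr => l _.
  rewrite (meval_eq (v2 := (pow_map r u) 0)) => [|l']; last by rewrite mxE.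
  rewrite -!mulrA; congr (_ * _).
  have -> : u 0 l ^ (r - m%:Z) = u 0 l ^ (r - 1) / u 0 l ^+ m.-1.
    by rewrite [u 0 l ^+ m.-1]exprnP invr_expz -expfzDr //; congr (_ ^ _); lia.
  have um : u 0 l ^+ m.-1 != 0 by rewrite expf_neq0.
  by field; rewrite mC um.
move: L0; rewrite LE sum_transfer => /eqP; rewrite subr_eq0 => /eqP/mulIf; apply.
by rewrite mulf_neq0 // invr_eq0.
Qed.

Lemma gradient_branch s r u (f : pol) : s != 0 -> r != 0 ->
  in_torus u -> \sum_l u 0 l ^ s = 0 -> vanishes_on (branch s r) f ->
  exists c, forall i, (f^`M(i)).@[(pow_map r u) 0] = c * u 0 i ^ (s - r).
Proof.
move=> s0 r0 tu su fB.
exists ((f^`M(ord0)).@[(pow_map r u) 0] * u 0 ord0 ^ (r - s)) => i.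
suff -> : (f^`M(ord0)).@[(pow_map r u) 0] * u 0 ord0 ^ (r - s) =
    (f^`M(i)).@[(pow_map r u) 0] * u 0 i ^ (r - s).
  by rewrite -mulrA -expfzDr // subrKA subrr mulr1.
case: s s0 su fB => m s0 su fB; first by apply: gradient_transfer; rewrite // lt0n.
(* Negative [s] reduces to positive [s] through the inverse point and the pair [(- s, - r)]. *)
pose v := pow_map (-1) u.
have ru : pow_map r u = pow_map (- r) v by rewrite -pow_mapM mulN1r opprK.
have uE l : u 0 l ^ (r - Negz m) = v 0 l ^ (- r - m.+1%:Z).
  by rewrite mxE exprz_exp; congr (_ ^ _); lia.
rewrite ru !uE; apply: gradient_transfer => //; rewrite ?oppr_eq0 //.
- exact: pow_map_torus.
- by rewrite -[RHS]su; apply: eq_bigr => l _; rewrite mxE exprz_exp mulN1r NegzE.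
- by rewrite -(@branch_mulz R n (-1)) // !mulN1r opprK -NegzE.
Qed.

(** * Density of points lying on a single branch *)

Definition torus_cont (H : vec -> C) := forall u (q : nat -> vec), in_torus u ->
  (forall i, tends (fun k => q k 0 i) (u 0 i)) -> tends (fun k => H (q k)) (H u).

(** Moving [u ^ s] along [transfer i j] changes the linear form [a] at the non-zero rate
    [a i - a j], so points where it does not vanish approach [u]. *)
Lemma branch_dense1 s (a : 'I_n.+1 -> C) i j (H : vec -> C) : s != 0 -> a i != a j ->
  torus_cont H ->
  (forall u, in_torus u -> \sum_l u 0 l ^ s = 0 -> \sum_l a l * u 0 l ^ s != 0 -> H u = 0) ->
  forall u, in_torus u -> \sum_l u 0 l ^ s = 0 -> H u = 0.
Proof.
move=> s0 aij Hc H0 u tu su.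
pose b l := cid (tends_rootz s0 (tu l) (tends_affine (u 0 l ^ s) (transfer i j l))).
pose q k : vec := \row_l projT1 (b l) k.
have qu l : tends (fun k => q k 0 l) (u 0 l).
  by apply: eq_tends (projT2 (b l)).1 => k; rewrite mxE.
have qE k l : q k 0 l ^ s = u 0 l ^ s + t k * transfer i j l.
  by rewrite mxE; exact: (projT2 (b l)).2.
apply: tends_uniq (Hc u q tu qu) _; apply: tends_eventually (tends_cst 0).
have aneq0 : eventually (fun k => \sum_l a l * u 0 l ^ s + t k * (a i - a j) != 0).
  by apply: affine_neq0 => //; rewrite orbC subr_eq0 aij.
apply: eventually_sub (eventuallyI aneq0
  (eventually_fin (fun l => tends_neq0 (qu l) (tu l)))) => k [h tq].
rewrite H0 //.
  rewrite (eq_bigr (fun l => u 0 l ^ s + t k * (1 * transfer i j l))) => [|l _].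
    by rewrite big_split -mulr_sumr (sum_transfer (fun=> 1)) /= su subrr mulr0 addr0.
  by rewrite qE mul1r.
rewrite (eq_bigr (fun l => a l * u 0 l ^ s + t k * (a l * transfer i j l))) => [|l _].
  by rewrite big_split -mulr_sumr sum_transfer.
by rewrite qE mulrDr mulrCA.
Qed.

Lemma branch_dense s (T : eqType) (l : seq T) (a : T -> 'I_n.+1 -> C) (H : vec -> C) :
  s != 0 -> (forall e, e \in l -> exists i j, a e i != a e j) -> torus_cont H ->
  (forall u, in_torus u -> \sum_i u 0 i ^ s = 0 ->
    (forall e, e \in l -> \sum_i a e i * u 0 i ^ s != 0) -> H u = 0) ->
  forall u, in_torus u -> \sum_i u 0 i ^ s = 0 -> H u = 0.
Proof.
move=> s0; elim: l H => [|e l IH] H al Hc H0; first by move=> u tu su; exact: H0.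
have [i [j aij]] := al e (mem_head _ _).
apply: (branch_dense1 s0 aij Hc) => u tu su au.
(* The form of [e] is multiplied into [H]: the product vanishes wherever the forms in the tail [l]
   are non-zero, so the induction hypothesis applies to it. *)
suff: (\sum_i a e i * u 0 i ^ s) * H u = 0.
  by move=> /eqP; rewrite mulf_eq0 (negPf au) => /eqP.
apply: (IH (fun v => (\sum_i a e i * v 0 i ^ s) * H v)) tu su => {u au}.
- by move=> e' e'l; apply: al; rewrite inE e'l orbT.
- move=> u q tu qu; apply: tendsM (Hc u q tu qu); apply: tends_sum => k.
  exact/tendsMl/tends_exprz.
- move=> u tu su h; have [->|au] := eqVneq (\sum_i a e i * u 0 i ^ s) 0.
    by rewrite mul0r.
  by rewrite H0 ?mulr0 // => e'; rewrite inE => /predU1P[->//|]; exact: h.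
Qed.

(** Keeps the coefficients [zeta ^ s] of a non-trivial twist from all being equal: [r] divides
    [k * s], hence [k]. *)
Lemma prim_root_exprz_coprime (r k : nat) s (w : C) : r.-primitive_root w ->
  coprime `|s| r -> (k < r)%N -> (w ^+ k) ^ s = 1 -> k = 0%N.
Proof.
move=> w_prim cop kr h.
have : (w ^+ k) ^+ `|s|%N = 1.
  case: s cop h => m _; first by [].
  by rewrite NegzE -exprnN => /eqP; rewrite invr_eq1 => /eqP.
rewrite -exprM => /eqP; rewrite -(prim_order_dvd w_prim).
rewrite Gauss_dvdl 1?coprime_sym // => /dvdnP[[|a] e]; first by rewrite e.
by move: kr; rewrite e mulSn ltnNge leq_addr.
Qed.

(* At a point [u ^ r] lying on a single branch, the norm polynomial is a
   non-vanishing factor times the local equation [\sum_i y_i ^ (s / r)]. *)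
Lemma norm_smooth s (r : nat) (w : C) (N : pol) (r0 : (0 < r)%N) u :
  s != 0 -> r.-primitive_root w ->
  (forall x, N.@[(pow_map r x) 0] =
    \prod_(e : {ffun 'I_n -> 'I_r}) (power_sum R n s).@[fun i => zeta w e i * x 0 i]) ->
  in_torus u -> \sum_i u 0 i ^ s = 0 ->
  (forall e : {ffun 'I_n -> 'I_r}, e != [ffun=> Ordinal r0] ->
    \sum_i zeta w e i ^ s * u 0 i ^ s != 0) ->
  (N^`M(ord0)).@[(pow_map r u) 0] != 0.
Proof.
move=> s0 w_prim NE tu su; set e0 := [ffun=> Ordinal r0] => hu; apply/eqP => N0.
have ze0 i : zeta w e0 i = 1 by exact: zeta0.
have zn0 (e : {ffun 'I_n -> 'I_r}) i : zeta w e i != 0 := zeta_neq0 w_prim e i.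
(* Only the coordinate [ord0] moves. The derivative of [N (q ^ r)] is computed twice: the chain rule
   gives 0 under the assumption [N0], while the product formula gives the derivative of the
   vanishing factor times the other factors, all non-zero. *)
pose q k : vec := \row_i (u 0 i + t k * (i == ord0)%:R).
have qE k i : q k 0 i = u 0 i + t k * (i == ord0)%:R by rewrite mxE.
have dq i : dtends t (fun k => q k 0 i) (u 0 i) (i == ord0)%:R.
  by apply: eq_dtends (dtends_lin t_neq0 _ _) => k; rewrite qE.
have qu i : tends (fun k => q k 0 i) (u 0 i) := dtends_tends t_neq0 t_tends0 (dq i).
have := dtends_meval t_neq0 t_tends0 N (fun i => dtends_exprz t_neq0 t_tends0 r (tu i) (dq i)).
have NEv x : N.@[fun i => x 0 i ^ r] = N.@[(pow_map r x) 0].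
  by apply: meval_eq => i; rewrite [RHS]mxE.
rewrite NEv (bigD1 ord0) //= big1 ?addr0 => [|i /negPf ->]; last by rewrite !mulr0.
rewrite (meval_eq (v2 := (pow_map r u) 0)) ?N0 ?mul0r => [|i]; last by rewrite mxE.
move=> lim0.
pose F v := (power_sum R n s).@[v 0].
have Fu : F u = 0 by exact/power_sum_torus0.
have prodE x : N.@[(pow_map r x) 0] = F x *
    \prod_(e | e != e0) (power_sum R n s).@[fun i => zeta w e i * x 0 i].
  rewrite NE (bigD1 e0) //=; congr (_ * _).
  by apply: meval_eq => i; rewrite ze0 mul1r.
pose Q x := \prod_(e | e != e0) (power_sum R n s).@[fun i => zeta w e i * x 0 i].
have limQ : tends (fun k => Q (q k)) (Q u).
  by apply: tends_prod => e; apply: tends_meval => i; exact: tendsMl.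
have Qu0 : Q u != 0.
  apply/prodf_neq0 => e ee0; rewrite power_sum_torusE // => [|i]; last by rewrite mulf_neq0.
  rewrite mulf_neq0 ?torus_unit_neq0 // => [i|]; first by rewrite mulf_neq0.
  by rewrite (eq_bigr (fun i => zeta w e i ^ s * u 0 i ^ s)) ?hu // => i _; rewrite expfzMl.
have limM : tends (fun k => torus_unit s (q k 0)) (torus_unit s (u 0)).
  rewrite /torus_unit; case: ifP => _; first exact: tends_cst.
  by apply: tends_prod => i; exact: tendsX.
have limS : dtends t (fun k => \sum_i q k 0 i ^ s) 0 (s%:~R * u 0 ord0 ^ (s - 1)).
  have S i := dtends_exprz t_neq0 t_tends0 s (tu i) (dq i).
  rewrite -[X in dtends _ _ _ X](_ : \sum_i s%:~R * u 0 i ^ (s - 1) * (i == ord0)%:R = _); last first.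
    rewrite (bigD1 ord0) //= big1 ?addr0 ?mulr1 // => i /negPf ->.
    by rewrite mulr0.
  apply: (@eq_tends _ (fun k => \sum_i (q k 0 i ^ s - u 0 i ^ s) / t k)).
    by move=> k; rewrite -mulr_suml sumrB su.
  exact: tends_sum.
have lim1 : tends (fun k => (N.@[fun i => q k 0 i ^ r] - N.@[(pow_map r u) 0]) / t k)
   (torus_unit s (u 0) * (s%:~R * u 0 ord0 ^ (s - 1)) * Q u).
  have := tendsM (tendsM limM limS) limQ; apply: tends_eventually.
  apply: eventually_sub (eventually_fin (fun i => tends_neq0 (qu i) (tu i))) => k tq.
  rewrite NEv !prodE Fu mul0r subr0 subr0 /F power_sum_torusE // -/(Q _).
  by rewrite mulrA mulrAC.
have /esym/eqP := tends_uniq lim0 lim1; apply/negP; rewrite !mulf_neq0 ?torus_unit_neq0 //.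
  by rewrite intr_eq0.
by rewrite expfz_neq0.
Qed.

(** The tangency point may be singular or outside the torus, where no parametrisation is at hand;
    the relation [G (grad f) = 0] is therefore proved on the branch and extended to the closure as a
    polynomial identity. *)
Lemma dual_sub s r : s != 0 -> r != 0 ->
  dual (zariski_closure (branch s r)) `<=` zariski_closure (@branch R n s (s - r)).
Proof.
move=> s0 r0; apply: zariski_closure_sub => h [h0 [x [Wx Tx]]]; split=> // e G hG GB.
have [i0 hi0] : exists i0, h 0 i0 != 0.
  apply/existsP; rewrite -negb_forall; apply: contra h0 => /forallP h0.
  by apply/eqP/rowP => i; rewrite mxE; exact/eqP.
(* If all gradients vanished at [x], the tangent space would contain the basis vector at [i0], which
   the hyperplane of [h] does not. *)
have [d [f [hf fW [i1 fi1]]]] : exists d (f : pol), [/\ f \is d.-homog,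
    vanishes_on (zariski_closure (branch s r)) f & exists i, (f^`M(i)).@[x 0] != 0].
  apply: contrapT => H.
  have : hyperplane h (delta_mx 0 i0).
    rewrite -Tx; split=> [|d f hf fW].
      by apply/eqP => /rowP/(_ i0); rewrite !mxE !eqxx => /eqP; rewrite oner_eq0.
    rewrite big1 // => i _; apply/eqP; rewrite mulf_eq0; apply/orP; left.
    by apply: contrapT => /negP fi; apply: H; exists d, f; split=> //; exists i.
  move=> [_]; rewrite (bigD1 i0) //= big1 => [|i /negPf ii0].
    by rewrite addr0 mxE !eqxx mulr1 => /eqP; rewrite (negPf hi0).
  by rewrite mxE ii0 andbF mulr0.
pose g i := (f^`M(i)).@[x 0].
(* The vectors [h_i0 e_i - h_i e_i0] lie in the hyperplane, hence are killed by [g]; so [g] is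
   proportional to [h]. *)
have gh i : g i = g i0 / h 0 i0 * h 0 i.
  have [->|ii0] := eqVneq i i0; first by rewrite divfK.
  have : tangent_space (zariski_closure (branch s r)) x
      (h 0 i0 *: delta_mx 0 i - h 0 i *: delta_mx 0 i0).
    rewrite Tx; split.
      apply/eqP => /rowP/(_ i); rewrite !mxE !eqxx (negPf ii0) andbF mulr0 subr0 mulr1.
      by move=> /eqP; rewrite (negPf hi0).
    rewrite (bigD1 i) //= (bigD1 i0) 1?eq_sym //= big1 => [|j /andP[ji ji0]].
      rewrite !mxE !eqxx (negPf ii0) eq_sym (negPf ii0) !andbF.
      by rewrite /=; ring.
    by rewrite !mxE (negPf ji) (negPf ji0) !andbF !mulr0 subr0 mulr0.
  move=> [_ /(_ d f hf fW)].
  rewrite (bigD1 i) //= (bigD1 i0) 1?eq_sym //= big1 => [|j /andP[ji ji0]].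
    rewrite !mxE !eqxx (negPf ii0) eq_sym (negPf ii0) !andbF -!/(g _).
    move=> E; apply: (mulIf hi0); rewrite mulrAC divfK //.
    by apply/eqP; rewrite -subr_eq0 -E; rewrite /=; apply/eqP; ring.
  by rewrite !mxE (negPf ji) (negPf ji0) !andbF !mulr0 subr0 mulr0.
have mu0 : g i0 / h 0 i0 != 0.
  by apply: contraNneq fi1 => mu0; rewrite -/(g i1) gh mu0 mul0r.
(* All gradients of [f] along the branch are multiples of points of [branch s (s - r)]. *)
pose P := G \mPo [tuple f^`M(i) | i < n.+1].
have hP : P \is (e * d.-1).-homog.
  by apply: dhomog_comp hG _ => i; rewrite tnth_mktuple dhomog_mderiv.
have PE y : P.@[y 0] = G.@[fun i => (f^`M(i)).@[y 0]].
  by rewrite comp_mpoly_meval; apply: meval_eq => i; rewrite tnth_mktuple.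
have fB : vanishes_on (branch s r) f.
  move=> y By; apply: fW; apply: sub_zariski_closure By; exact: branch_neq0.
have PB : vanishes_on (branch s r) P.
  move=> _ [u [tu su ->]]; rewrite PE.
  have [c fc] := gradient_branch s0 r0 tu su fB.
  rewrite (meval_eq (v2 := fun i => c * (pow_map (s - r) u) 0 i)) => [|i]; last first.
    by rewrite fc mxE.
  by rewrite (dhomog_meval _ _ hG) GB ?mulr0 //; exists u.
have := Wx.2 _ _ hP PB; rewrite PE (meval_eq (v2 := fun i => g i0 / h 0 i0 * h 0 i)) //.
by move=> /eqP; rewrite (dhomog_meval _ _ hG) mulf_eq0 expf_eq0 (negPf mu0) andbF => /eqP.
Qed.

(** Coprimality makes every non-trivial twist a linear form in [u ^ s] with non-constant
    coefficients, so points avoiding all of them are dense on the branch; there the tangent space is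
    the hyperplane of [v ^ (s - r)]. *)
Lemma sub_dual s (r : nat) : (0 < n)%N -> s != 0 -> (0 < r)%N -> coprime `|s| r ->
  zariski_closure (@branch R n s (s - r%:Z)) `<=` dual (zariski_closure (branch s r)).
Proof.
move=> n_gt0 s0 r0 cop; have [w w_prim] := prim_root_exists C r0.
have [N [D [_ hN NE]]] := power_sum_norm n_gt0 s0 w_prim.
have rz : (r : int) != 0 by lia.
apply: zariski_closure_sub => _ [u [tu su ->]].
split=> [|d G hG GA]; first exact/torus_neq0/pow_map_torus.
pose H v := G.@[(pow_map (s - r%:Z) v) 0]; rewrite -/(H u).
pose e0 : {ffun 'I_n -> 'I_r} := [ffun=> Ordinal r0].
have Hc : torus_cont H.
  move=> v q tv qv; apply: tends_meval => i; rewrite mxE.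
  by apply: eq_tends (tends_exprz _ (qv i) (tv i)) => k; rewrite [RHS]mxE.
have nonconst e : e \in [seq e <- index_enum {ffun 'I_n -> 'I_r} | e != e0] ->
    exists i j, zeta w e (i : 'I_n.+1) ^ s != zeta w e j ^ s.
  rewrite mem_filter => /andP[ee0 _].
  have [j ej] : exists j, e j != Ordinal r0.
    apply/existsP; rewrite -negb_forall; apply: contra ee0 => /forallP e_0.
    by apply/eqP/ffunP => j; rewrite ffunE; exact/eqP.
  exists (lift ord0 j), ord0; rewrite /zeta liftK unlift_none exp1rz.
  apply: contraNneq ej => h; apply/eqP/val_inj => /=.
  exact: prim_root_exprz_coprime w_prim cop (ltn_ord _) h.
apply: (branch_dense s0 nonconst Hc _ tu su) => v tv sv good.
apply: GA; split; first exact/torus_neq0/pow_map_torus.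
exists (pow_map r v).
have vB : branch s r (pow_map r v) by exists v.
split; first by apply: sub_zariski_closure vB; exact: branch_neq0.
have fB f : vanishes_on (zariski_closure (branch s r)) f -> vanishes_on (@branch R n s r) f.
  move=> fW y By; apply: fW; apply: sub_zariski_closure By; exact: branch_neq0.
(* The non-zero gradient of [N] puts the tangent space inside the hyperplane; the converse holds as
   every gradient is a multiple of [v ^ (s - r)]. *)
apply/seteqP; split=> y [y0 hy]; split=> //.
  have NW : vanishes_on (zariski_closure (branch s r)) N.
    by move=> x; rewrite -pow_image_closure // -(norm_zero_locus w_prim hN NE) => -[].
  have [c Nc] := gradient_branch s0 rz tv sv (fB _ NW).
  have : (N^`M(ord0)).@[(pow_map r v) 0] != 0.
    apply: (norm_smooth (r0 := r0) s0 w_prim NE) => // e ee0.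
    by apply: good; rewrite mem_filter ee0 mem_index_enum.
  rewrite Nc mulf_eq0 negb_or => /andP[c0 _].
  have := hy _ _ hN NW; rewrite (eq_bigr (fun i => c * (pow_map (s - r%:Z) v 0 i * y 0 i))).
    by rewrite -mulr_sumr => /eqP; rewrite mulf_eq0 (negPf c0) => /eqP.
  by move=> i _; rewrite Nc [in RHS]mxE mulrA.
move=> d' f hf fW; have [c fc] := gradient_branch s0 rz tv sv (fB _ fW).
rewrite (eq_bigr (fun i => c * (pow_map (s - r%:Z) v 0 i * y 0 i))).
  by rewrite -mulr_sumr hy mulr0.
by move=> i _; rewrite fc [in RHS]mxE mulrA.
Qed.

End Duals.

(** * Generalised power sums *)

Section GeneralisedPowerSums.
Variables (R : realType) (n : nat).
Hypothesis n_gt0 : (0 < n)%N.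
Implicit Types (p : rat) (s r : int).

(** Lowest terms with positive denominator, the form that [sub_dual] requires. *)
Definition closed_branch p := zariski_closure (@branch R n (numq p) (denq p)).

Lemma closed_branch_ratio s r p : s != 0 -> r != 0 -> p = s%:~R / r%:~R ->
  zariski_closure (branch s r) = closed_branch p.
Proof.
move=> s0 r0 pE.
have p0 : p != 0 by rewrite pE mulf_neq0 ?invr_eq0 ?intr_eq0.
congr zariski_closure; apply: branch_ratio; rewrite ?numq_eq0 //.
apply: (@intr_inj rat); rewrite !intrM.
move: pE; rewrite -{1}(divq_num_den p) => /eqP; rewrite eqr_div ?intr_eq0 ?denq_neq0 //.
by move=> /eqP ->.
Qed.

Lemma reciprocal_closed_branch p : p != 0 ->
  reciprocal (closed_branch p) = closed_branch (- p).
Proof.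
move=> p0; rewrite /closed_branch reciprocal_closure ?numq_eq0 ?denq_neq0 //.
apply: closed_branch_ratio; rewrite ?numq_eq0 ?oppr_eq0 ?denq_neq0 //.
by rewrite mulrNz invrN mulrN divq_num_den.
Qed.

Lemma dual_closed_branch p : p != 0 -> p != 1 ->
  dual (closed_branch p) = closed_branch (p / (p - 1)).
Proof.
move=> p0 p1; rewrite /closed_branch.
have s0 : numq p != 0 by rewrite numq_eq0.
have r0 := denq_neq0 p.
have := coprime_num_den p; have := denq_gt0 p; have pE := divq_num_den p.
move: s0 r0 pE; move: (numq p) (denq p) => s [r|r] // s0 r0 pE rpos cop.
(* The new pair is [(s, s - r)], a valid exponent exactly because [p != 1]. *)
have sr : s - r%:Z != 0.
  apply: contra_neq p1 => /eqP; rewrite subr_eq0 => /eqP sr.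
  by rewrite -pE sr divff // intr_eq0.
rewrite -/(closed_branch _) -(closed_branch_ratio s0 sr).
  by apply/seteqP; split; [exact: dual_sub|exact: sub_dual].
have rQ : (r%:Z%:~R : rat) != 0 by rewrite intr_eq0.
rewrite -pE intrB.
have srQ : (s%:~R - r%:Z%:~R : rat) != 0 by rewrite -intrB intr_eq0.
by field; rewrite srQ rQ.
Qed.

Lemma square_free_defining_exists s (r : nat) : s != 0 -> (0 < r)%N ->
  exists f, square_free_defining (coord_pow r (zero_locus (power_sum R n s))) f.
Proof.
move=> s0 r0; have [w w_prim] := prim_root_exists R[i] r0.
have [N [D [N0 hN NE]]] := power_sum_norm n_gt0 s0 w_prim.
rewrite /coord_pow ltz_nat r0 -(norm_zero_locus w_prim hN NE).
exact: square_free_exists N0 hN.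
Qed.

Lemma zero_locus_gen_power_sum p : p != 0 ->
  zero_locus (gen_power_sum R n p) = closed_branch p.
Proof.
move=> p0.
(* Existence, shown with lowest terms, rules out the default 1 of [xget]. The chosen [s] and [r]
   stay arbitrary, and any choice gives the same closure. *)
have [s [r [r0 pE]]] : is_gen_power_sum p (gen_power_sum R n p).
  apply: xgetPex.
  have s0 : numq p != 0 by rewrite numq_eq0.
  have := denq_gt0 p; have := divq_num_den p.
  case: (denq p) => // r pE rpos.
  have [f hf] := square_free_defining_exists s0 rpos.
  exists f, (numq p), r; split=> //; first by rewrite gt_eqF.
  by rewrite (negPf s0).
have s0 : s != 0 by apply: contra_neq p0 => s0; rewrite pE s0 mul0r.
rewrite (negPf s0) => -[_ _ ->].
by rewrite coord_pow_closure // (closed_branch_ratio s0 r0 pE).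
Qed.

End GeneralisedPowerSums.

(** * Iteration of one step on the exponent *)

Theorem theorem3p13 (R : realType) (n : nat) (hn : (1 <= n)%N) :
  (forall (k : nat) (p : rat),
     p != 0 ->
     (forall j : nat, (1 <= j <= k)%N -> p != - (j%:R)^-1) ->
     iter k (fun X => dual (reciprocal X)) (zero_locus (gen_power_sum R n p))
     = zero_locus (gen_power_sum R n (p / (1 + k%:R * p))))
  /\
  (forall (k : nat) (p : rat),
     p != 0 ->
     (forall j : nat, (1 <= j <= k)%N -> p != (j%:R)^-1) ->
     iter k (fun X => reciprocal (dual X)) (zero_locus (gen_power_sum R n p))
     = zero_locus (gen_power_sum R n (p / (1 - k%:R * p)))).
Proof.
(* The excluded exponents are the zeros of the denominators: [a = 1] serves the first formula and
   [a = -1], up to sign, the second. *)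
have den_neq0 (a p : rat) k : p != 0 -> a != 0 ->
    (forall j, (1 <= j <= k)%N -> p != - (a * j%:R^-1)) ->
    forall j, (j <= k)%N -> a + j%:R * p != 0.
  move=> p0 a0 hp [|j] jk; first by rewrite mul0r addr0.
  apply: contraNneq (hp j.+1 jk) => h; apply/eqP.
  have jQ : (j.+1%:R : rat) != 0 by rewrite pnatr_eq0.
  by apply: (mulfI jQ); rewrite mulrN mulrCA divff // mulr1 -[RHS]add0r -h addrAC subrr add0r.
split=> k p p0 hp.
  have nz j : (j <= k)%N -> 1 + j%:R * p != 0.
    by apply: den_neq0 => // i /hp; rewrite mul1r.
  elim: k hp nz => [|k IH] hp nz; first by rewrite /= mul0r addr0 divr1.
  have d0 : 1 + k%:R * p != 0 by apply: nz.
  have d1 : 1 + k.+1%:R * p != 0 by apply: nz.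
  (* One step is [q |-> - q |-> q / (q + 1)]; this value of [q + 1] is non-zero, so [- q != 1] and
     the dual can be taken. *)
  have dE : p / (1 + k%:R * p) + 1 = (1 + k.+1%:R * p) / (1 + k%:R * p).
    by rewrite -natr1; field.
  rewrite iterS IH; first last.
  - by move=> j jk; apply: nz; exact: leqW.
  - by move=> j /andP[j0 jk]; apply: hp; rewrite j0 leqW.
  have q0 : p / (1 + k%:R * p) != 0 by rewrite mulf_neq0 ?invr_eq0.
  rewrite !zero_locus_gen_power_sum ?mulf_neq0 ?invr_eq0 //.
  rewrite reciprocal_closed_branch // dual_closed_branch ?oppr_eq0 //; last first.
    rewrite eqr_oppLR -subr_eq0 opprK dE.
    by rewrite mulf_neq0 ?invr_eq0.
  congr closed_branch; rewrite -opprD invrN mulrNN dE.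
  by rewrite invf_div mulrA divfK.
have nz j : (j <= k)%N -> 1 - j%:R * p != 0.
  move=> jk; rewrite -oppr_eq0 opprB addrC; apply: (den_neq0 _ _ k) => //.
  by move=> i /hp; rewrite mulN1r opprK.
elim: k hp nz => [|k IH] hp nz; first by rewrite /= mul0r subr0 divr1.
have d0 : 1 - k%:R * p != 0 by apply: nz.
have d1 : 1 - k.+1%:R * p != 0 by apply: nz.
(* Here the dual comes first: [q |-> q / (q - 1) |-> q / (1 - q)], which asks for [q != 1]. *)
have dE : 1 - p / (1 - k%:R * p) = (1 - k.+1%:R * p) / (1 - k%:R * p).
  by rewrite -natr1; field.
rewrite iterS IH; first last.
- by move=> j jk; apply: nz; exact: leqW.
- by move=> j /andP[j0 jk]; apply: hp; rewrite j0 leqW.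
have q0 : p / (1 - k%:R * p) != 0 by rewrite mulf_neq0 ?invr_eq0.
have q1 : 1 - p / (1 - k%:R * p) != 0 by rewrite dE mulf_neq0 ?invr_eq0.
rewrite !zero_locus_gen_power_sum ?mulf_neq0 ?invr_eq0 //.
rewrite dual_closed_branch //; last by rewrite eq_sym -subr_eq0.
rewrite reciprocal_closed_branch //; last by rewrite mulf_neq0 // invr_eq0 -oppr_eq0 opprB.
congr closed_branch; rewrite -mulrN -invrN opprB dE.
by rewrite invf_div mulrA divfK.
Qed.
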